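(* Let $f\colon\mathbb{R}^n\to[-\infty,+\infty]$ be absolutely symmetric, lower semicontinuous, convex, and locally Lipschitz continuous relative to its domain. Assume that $Y\in\partial(f\circ\sigma)(X)$, where $X,Y\in\mathbb{M}_{m,n}$, and that $f$ is parabolically epi-differentiable at $\sigma(X)$ and parabolically regular at $\sigma(X)$ for $\sigma(Y)$. Then $f\circ\sigma$ is twice epi-differentiable at $X$ for $Y$.
   Context: $m,n$ are natural numbers, $n\le m$; $\mathbb{M}_{m,n}$ is the space of real $m\times n$ matrices, $\langle A,B\rangle=\mathrm{tr}(A^TB)$, Frobenius norm. $\sigma(X)$ is the vector of singular values in nonincreasing order. $f$ is absolutely symmetric if $f(Qx)=f(x)$ for all $x$ and all signed permutation matrices $Q$ (entries in $\{0,\pm1\}$, one nonzero entry per row and column). $g$ is locally Lipschitz continuous relative to its domain if for every $\bar x\in\mathrm{dom}\,g=\{g<\infty\}$, $g(\bar x)$ is finite and $g$ is Lipschitz on $O\cap\mathrm{dom}\,g$ for some neighborhood $O$ of $\bar x$. $\partial$ is the convex subdifferential. For $g$ with $g(\bar x)$ finite: $\mathrm{d}g(\bar x)(w)=\liminf_{t\downarrow0,w'\to w}\frac{g(\bar x+tw')-g(\bar x)}t$; $\bigtriangleup^2_\tau g(\bar x\mid v)(w)=\frac{g(\bar x+\tau w)-g(\bar x)-\tau\langle v,w\rangle}{\frac12\tau^2}$; $\mathrm{d}^2g(\bar x\mid v)(w)=\liminf_{\tau\downarrow0,w'\to w}\bigtriangleup^2_\tau g(\bar x\mid v)(w')$.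 $g$ is twice epi-differentiable at $\bar x$ for $v$ if $\bigtriangleup^2_\tau g(\bar x\mid v)$ epi-converges to $\mathrm{d}^2g(\bar x\mid v)$ as $\tau\downarrow0$, i.e. for every $w$ and every $\tau_k\downarrow0$ there is $w_k\to w$ with $\bigtriangleup^2_{\tau_k}g(\bar x\mid v)(w_k)\to\mathrm{d}^2g(\bar x\mid v)(w)$. For $\mathrm{d}g(\bar x)(w)$ finite, $\mathrm{d}^2g(\bar x)(w\mid z)=\liminf_{\tau\downarrow0,z'\to z}\frac{g(\bar x+\tau w+\frac12\tau^2z')-g(\bar x)-\tau\mathrm{d}g(\bar x)(w)}{\frac12\tau^2}$. $g$ is parabolically epi-differentiable at $\bar x$ if for every $w$ with $\mathrm{d}g(\bar x)(w)$ finite: $\mathrm{dom}\,\mathrm{d}^2g(\bar x)(w\mid\cdot)\neq\emptyset$ and for every $z$ and $\tau_k\downarrow0$ there is $z_k\to z$ with $\frac{g(\bar x+\tau_kw+\frac12\tau_k^2z_k)-g(\bar x)-\tau_k\mathrm{d}g(\bar x)(w)}{\frac12\tau_k^2}\to\mathrm{d}^2g(\bar x)(w\mid z)$. $g$ is parabolically regular at $\bar x$ for $v$ if $g(\bar x)$ is finite and $\mathrm{d}^2g(\bar x\mid v)(w)=\inf_z\{\mathrm{d}^2g(\bar x)(w\mid z)-\langle v,z\rangle\}$ for every $w$ with $\mathrm{d}g(\bar x)(w)=\langle v,w\rangle$. *)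

(* Defs.v *)
From HB Require Import structures.
From mathcomp Require Import all_boot all_order all_algebra.
From mathcomp Require Import all_classical all_reals all_analysis.
From mathcomp Require Import complex.

Set Implicit Arguments.
Unset Strict Implicit.
Unset Printing Implicit Defensive.

Import Order.TTheory GRing.Theory Num.Theory.
Import numFieldTopology.Exports numFieldNormedType.Exports.

Local Open Scope classical_set_scope.
Local Open Scope ring_scope.

(* Everything below is stated once for the Euclidean space 'M[R]_(p, q);
   R^n is the case of column vectors 'cV[R]_n = 'M[R]_(n, 1), where [inner] is
   the standard inner product and [normF] the Euclidean norm. *)

Section Euclidean.
Context {R : realType} {p q : nat}.
Implicit Types A B : 'M[R]_(p, q).

Definition inner A B : R := \tr (A^T *m B).

Definition normF A : R := Num.sqrt (inner A A).

End Euclidean.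

Section VariationalAnalysis.
Context {R : realType} {p q : nat}.
Local Notation E := 'M[R]_(p, q).
Implicit Types (g : E -> \bar R) (x v w z : E).
Local Open Scope ereal_scope.

Definition dom g : set E := [set x | g x < +oo].

Definition epigraph g : set (convex_lmodType (E * R^o)%type) :=
  [set xa | g xa.1 <= (xa.2 : R)%:E].

(* For functions that may take both infinite values, convexity is convexity of
   the epigraph. *)
Definition convex_efun g := convex_set (epigraph g).

(* The first condition, at all points of dom g, makes g x and g y finite in the
   Lipschitz inequality. *)
Definition locally_lipschitz_on_dom g :=
  forall xbar, dom g xbar -> g xbar \is a fin_num /\
    exists2 O : set E, nbhs xbar O &
    exists L : R, forall x y, (O `&` dom g) x -> (O `&` dom g) y ->
      `|g x - g y| <= (L * normF (x - y))%:E.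

Definition convex_subdiff g xbar : set E :=
  [set v | g xbar \is a fin_num /\
           forall x, g xbar + (inner v (x - xbar))%:E <= g x].

(* The lower limit of D t w' as t decreases to 0 (t > 0) and w' tends to w. *)
Definition liminf_right (D : R -> E -> \bar R) w : \bar R :=
  limf_einf (fun tw : R * E => D tw.1 tw.2) (filter_prod (0%R : R)^'+ (nbhs w)).

(* l is the limit of D along some w_k --> w for every t_k decreasing to 0; as
   usual in variational analysis, the latter means t_k > 0 and t_k --> 0. *)
Definition recovery (D : R -> E -> \bar R) w (l : \bar R) :=
  forall t : nat -> R, (forall k, 0 < t k)%R -> t @ \oo --> (0 : R)%R ->
  exists2 u : nat -> E, u @ \oo --> w & D (t k) (u k) @[k --> \oo] --> l.

Definition subderiv g xbar w : \bar R :=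
  liminf_right (fun t w' => (g (xbar + t *: w')%R - g xbar) * (t^-1)%:E) w.

Definition second_quot g xbar v (t : R) w : \bar R :=
  (g (xbar + t *: w)%R - g xbar - (t * inner v w)%:E)
    * ((2^-1 * t ^+ 2)^-1)%:E.

Definition second_subderiv g xbar v w : \bar R :=
  liminf_right (second_quot g xbar v) w.

Definition twice_epi_differentiable g xbar v :=
  g xbar \is a fin_num /\
  forall w, recovery (second_quot g xbar v) w (second_subderiv g xbar v w).

Definition parabolic_quot g xbar w (t : R) z : \bar R :=
  (g (xbar + t *: w + (2^-1 * t ^+ 2) *: z)%R - g xbar
     - t%:E * subderiv g xbar w) * ((2^-1 * t ^+ 2)^-1)%:E.

Definition parabolic_subderiv g xbar w z : \bar R :=
  liminf_right (parabolic_quot g xbar w) z.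

Definition parabolically_epi_differentiable g xbar :=
  g xbar \is a fin_num /\
  forall w, subderiv g xbar w \is a fin_num ->
    (exists z, parabolic_subderiv g xbar w z < +oo) /\
    forall z, recovery (parabolic_quot g xbar w) z
                       (parabolic_subderiv g xbar w z).

Definition parabolically_regular g xbar v :=
  g xbar \is a fin_num /\
  forall w, subderiv g xbar w = (inner v w)%:E ->
    second_subderiv g xbar v w =
    ereal_inf [set parabolic_subderiv g xbar w z - (inner v z)%:E | z in setT].

End VariationalAnalysis.

Section AbsolutelySymmetric.
Context {R : realType} {n : nat}.

Definition signed_perm_mx (Q : 'M[R]_n) :=
  [/\ forall i j, Q i j \in [:: 0; 1; -1],
      forall i, exists! j, Q i j != 0 &
      forall j, exists! i, Q i j != 0].

Definition absolutely_symmetric (f : 'cV[R]_n -> \bar R) :=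
  forall (Q : 'M[R]_n) (x : 'cV[R]_n), signed_perm_mx Q -> f (Q *m x) = f x.

End AbsolutelySymmetric.

Section SingularValues.
Context {R : realType} {m n : nat}.
Implicit Types (X : 'M[R]_(m, n)) (s : 'cV[R]_n).

(* s lists, in nonincreasing order, the nonnegative square roots of the
   eigenvalues of X^T X, repeated according to multiplicity. *)
Definition is_singular_values X s :=
  [/\ forall i, 0 <= s i 0,
      forall i j : 'I_n, (i <= j)%N -> s j 0 <= s i 0 &
      char_poly (X^T *m X) = \prod_(i < n) ('X - (s i 0 ^+ 2)%:P)].

(* The default value 0 is never used, see [singular_valuesP]. *)
Definition singular_values X : 'cV[R]_n := xget 0 (is_singular_values X).

End SingularValues.

Lemma char_poly_conj (F : fieldType) n (P D : 'M[F]_n) : P \in unitmx ->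
  char_poly (invmx P *m D *m P) = char_poly D.
Proof.
move=> Pu; rewrite /char_poly.
have -> : char_poly_mx (invmx P *m D *m P) =
    map_mx polyC (invmx P) *m char_poly_mx D *m map_mx polyC P.
  rewrite /char_poly_mx mulmxBr mulmxBl -!map_mxM mul_mx_scalar -scalemxAl.
  by rewrite -map_mxM mulVmx// map_mx1 scalemx1.
rewrite !det_mulmx mulrAC -det_mulmx -map_mxM mulVmx// map_mx1 det1.
by rewrite mul1r.
Qed.

Lemma char_poly_sym_split (R : rcfType) n (A : 'M[R]_n) : A^T = A ->
  exists r : 'I_n -> R, char_poly A = \prod_(i < n) ('X - (r i)%:P).
Proof.
move=> symA; pose B := map_mx (real_complex R) A.
have hermB : B \is hermsymmx.
  apply: realsym_hermsym.
    apply/is_hermitianmxP; rewrite expr0 scale1r map_mx_id//.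
    by apply/matrixP => i j; rewrite !mxE -{1}symA mxE.
  by apply/mxOverP => i j; rewrite mxE complex_real.
have /hermitian_normalmx/orthomx_spectralP eB := hermB.
have /mxOverP realD := hermitian_spectral_diag_real hermB.
have P_unit := spectral_unit B.
exists (fun i => complex.Re (spectral_diag B 0 i)).
apply: (map_poly_inj (real_complex R)).
rewrite map_char_poly -/B rmorph_prod /=.
rewrite [in LHS]eB char_poly_conj// char_poly_trig ?diag_mx_is_trig//.
apply: eq_bigr => i _; rewrite mxE eqxx mulr1n rmorphB /= map_polyX map_polyC /=.
by rewrite RRe_real.
Qed.

Lemma singular_valuesP (R : realType) m n (X : 'M[R]_(m, n)) :
  is_singular_values X (singular_values X).
Proof.
apply: xgetPex.
have symG : (X^T *m X)^T = X^T *m X by rewrite trmx_mul trmxK.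
have [r er] := char_poly_sym_split symG.
have r_ge0 i : 0 <= r i.
  have : root (char_poly (X^T *m X)) (r i).
    by rewrite er (bigD1 i)//= rootM root_XsubC eqxx.
  rewrite -eigenvalue_root_char => /eigenvalueP[v ev vn0].
  have nneg k (u : 'rV[R]_k) : (u *m u^T) 0 0 = \sum_j u 0 j ^+ 2.
    by rewrite mxE; apply: eq_bigr => j _; rewrite mxE expr2.
  have vv_gt0 : 0 < (v *m v^T) 0 0.
    rewrite nneg lt_def sumr_ge0 ?andbT => [|j _]; last exact: sqr_ge0.
    apply: contra vn0; rewrite psumr_eq0 => [/allP v0|j _]; last exact: sqr_ge0.
    apply/eqP/rowP => j; rewrite mxE; apply/eqP.
    by rewrite -sqrf_eq0; exact: (implyP (v0 j (mem_index_enum j))).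
  rewrite -(pmulr_lge0 _ vv_gt0).
  suff -> : r i * (v *m v^T) 0 0 = ((v *m X^T) *m (v *m X^T)^T) 0 0.
    by rewrite nneg sumr_ge0// => j _; exact: sqr_ge0.
  by rewrite trmx_mul trmxK mulmxA -(mulmxA v) ev -scalemxAl [RHS]mxE.
pose l := sort >=%R (codom r).
have sz_l : size l = n by rewrite size_sort size_codom card_ord.
have l_sorted : sorted >=%R l by apply: sort_sorted => x y; exact: ge_total.
have l_ge0 i : 0 <= l`_i.
  have [lti|] := ltnP i (size l); last by move=> lei; rewrite nth_default.
  have := mem_nth 0 lti; rewrite mem_sort => /codomP[j ->]; exact: r_ge0.
exists (\col_i Num.sqrt l`_i); split => [i|i j leij|].
- by rewrite mxE sqrtr_ge0.
- rewrite !mxE ler_wsqrtr//.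
  have := sorted_leq_nth ge_trans lexx 0 l_sorted i j.
  by rewrite !inE sz_l !ltn_ord; apply.
- have -> : char_poly (X^T *m X) = \prod_(x <- codom r) ('X - x%:P).
    by rewrite er big_image.
  rewrite (perm_big l) 1?perm_sym ?perm_sort//= (big_nth 0) sz_l big_mkord.
  by apply: eq_bigr => i _; rewrite mxE sqr_sqrtr.
Qed.

Lemma is_singular_values_unique (R : realType) m n (X : 'M[R]_(m, n)) s s' :
  is_singular_values X s -> is_singular_values X s' -> s = s'.
Proof.
have sorted_cod (u : 'cV[R]_n) :
    (forall i, 0 <= u i 0) ->
    (forall i j : 'I_n, (i <= j)%N -> u j 0 <= u i 0) ->
    sorted >=%R (codom (fun i => u i 0 ^+ 2)).
  move=> u_ge0 u_dec; rewrite /codom /image_mem sorted_map.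
  have : sorted (relpre val ltn) (enum 'I_n).
    by rewrite -sorted_map val_enum_ord iota_ltn_sorted.
  apply: sub_sorted => i j /= /ltnW /u_dec ji.
  by rewrite ler_sqr ?nnegrE.
move=> [s0 sd sP] [t0 td tP].
have : codom (fun i => s i 0 ^+ 2) = codom (fun i => s' i 0 ^+ 2).
  apply: (sorted_eq ge_trans ge_anti); [exact: sorted_cod..|].
  apply: prod_XsubC_eq.
  by rewrite !big_image; exact: etrans (esym sP) tP.
move=> /eq_in_map st; apply/colP => i.
by apply: (@pexpIrn R 2); rewrite ?nnegrE// st// mem_enum.
Qed.

(* Main.v *)
Require Import Defs.
From HB Require Import structures.
From mathcomp Require Import all_boot all_order all_algebra.
From mathcomp Require Import all_classical all_reals all_analysis.
From mathcomp Require Import fingroup perm ring lra.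

Set Implicit Arguments.
Unset Strict Implicit.
Unset Printing Implicit Defensive.

Import Order.TTheory GRing.Theory Num.Theory.
Import numFieldTopology.Exports numFieldNormedType.Exports.

Local Open Scope classical_set_scope.
Local Open Scope ring_scope.

(** Write [g = f o sigma], [x = sigma X], [y = sigma Y], and [Dz] for the
    rectangular diagonal matrix with diagonal [z].  Since [Y] is a subgradient,
    [<X, Y> = <x, y>], and for [t > 0] the second-order quotient of [g] at
    [X + t W'] splits exactly ([second_quot_spectral]) into that of [f] at
    [sigma (X + t W')] and the gap in von Neumann's trace inequality,
    [(<y, sigma (X + t W')> - <Y, X + t W'>) / (t^2 / 2)].  Both terms are
    nonnegative.

    Fix a direction [W].  Maximizing a linear functional over the compact
    stabilizer of [Dx] produces a frame of singular vectors of [X] in which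
    [W = U (Dw + A Dx - Dx B) V^T] with [A], [B] skew ([adapted_frame]); then [w]
    is the directional derivative of [sigma] at [X] along [W]
    ([cvg_singular_values_quotient]).  If the second subderivative of [g] along
    [W] is finite, both terms of the splitting stay bounded along some sequence,
    so that [<Y, W> = <y, w>] and [df(x)(w) = <y, w>]; equality in von Neumann's
    inequality then allows the frame to be changed so that it also diagonalizes
    [Y] ([critical_frame]).

    Let the frame turn along the Cayley transforms [C_A(t)], [C_B(t)].  Testing
    von Neumann's inequality on [Y] transported along this motion bounds the
    trace gap divided by [t^2 / 2] from below, in the limit, by a number [L]
    depending on [A], [B], [x], [y] only ([trace_gap_lower_bound]).  Conversely,
    for the curves [X_k = U C_A(t_k) D(z_k) C_B(t_k)^T V^T] the same quotient
    tends to exactly [L] ([cvg_trace_gap_curve]), while [g (X_k) = f (z_k)] holds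
    by absolute symmetry, whatever the order and the signs of the entries of
    [z_k] ([spectral_rdiag]).  Taking for [z_k] a parabolic recovery sequence of
    [f] gives approximate recovery sequences for [g] with limits
    [d^2 f(x)(w | z) - <y, z> + L] ([parabolic_lift]).  By parabolic regularity the
    infimum over [z] of these values is [d^2 f(x | y)(w) + L], which by the lower
    bound is at most [d^2 g(X | Y)(W)] ([second_subderiv_lower_bound]).  A diagonal
    extraction ([recovery_of_approx]) concludes. *)

(** * Frobenius inner product and orthogonal matrices *)

Section InnerProduct.
Context {R : realType}.

Lemma innerE p q (A B : 'M[R]_(p, q)) :
  inner A B = \sum_i \sum_j A i j * B i j.
Proof.
rewrite /inner /mxtrace exchange_big; apply: eq_bigr => j _ /=.
by rewrite mxE; apply: eq_bigr => i _; rewrite mxE.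
Qed.

Lemma innerC p q (A B : 'M[R]_(p, q)) : inner A B = inner B A.
Proof. by rewrite /inner -mxtrace_tr trmx_mul trmxK. Qed.

Lemma innerDr p q (A B C : 'M[R]_(p, q)) :
  inner A (B + C) = inner A B + inner A C.
Proof. by rewrite /inner mulmxDr mxtraceD. Qed.

Lemma innerZr p q (a : R) (A B : 'M[R]_(p, q)) :
  inner A (a *: B) = a * inner A B.
Proof. by rewrite /inner -scalemxAr mxtraceZ. Qed.

Lemma innerDl p q (A B C : 'M[R]_(p, q)) :
  inner (A + B) C = inner A C + inner B C.
Proof. by rewrite innerC innerDr !(innerC C). Qed.

Lemma innerZl p q (a : R) (A B : 'M[R]_(p, q)) :
  inner (a *: A) B = a * inner A B.
Proof. by rewrite innerC innerZr innerC. Qed.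

Lemma innerNr p q (A B : 'M[R]_(p, q)) : inner A (- B) = - inner A B.
Proof. by rewrite -scaleN1r innerZr mulN1r. Qed.

Lemma innerNl p q (A B : 'M[R]_(p, q)) : inner (- A) B = - inner A B.
Proof. by rewrite -scaleN1r innerZl mulN1r. Qed.

Lemma inner0r p q (A : 'M[R]_(p, q)) : inner A 0 = 0.
Proof. by rewrite -(scale0r 0) innerZr mul0r. Qed.

Lemma innerBr p q (A B C : 'M[R]_(p, q)) :
  inner A (B - C) = inner A B - inner A C.
Proof. by rewrite innerDr innerNr. Qed.

Lemma innerBl p q (A B C : 'M[R]_(p, q)) :
  inner (A - B) C = inner A C - inner B C.
Proof. by rewrite innerDl innerNl. Qed.

Lemma inner_sumr p q (I : finType) (A : 'M[R]_(p, q)) (F : I -> 'M[R]_(p, q)) :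
  inner A (\sum_i F i) = \sum_i inner A (F i).
Proof. by elim/big_rec2: _ => [|i y B _ <-]; rewrite ?inner0r ?innerDr. Qed.

Lemma inner_suml p q (I : finType) (A : 'M[R]_(p, q)) (F : I -> 'M[R]_(p, q)) :
  inner (\sum_i F i) A = \sum_i inner (F i) A.
Proof. by rewrite innerC inner_sumr; apply: eq_bigr => i _; rewrite innerC. Qed.

Lemma inner_mull p q r (U : 'M[R]_(p, q)) (A : 'M[R]_(q, r)) B :
  inner (U *m A) B = inner A (U^T *m B).
Proof. by rewrite /inner trmx_mul mulmxA. Qed.

Lemma inner_mulr p q r (A : 'M[R]_(p, q)) (V : 'M[R]_(q, r)) B :
  inner (A *m V) B = inner A (B *m V^T).
Proof. by rewrite /inner trmx_mul -mulmxA mxtrace_mulC !mulmxA. Qed.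

Lemma inner_ge0 p q (A : 'M[R]_(p, q)) : 0 <= inner A A.
Proof.
by rewrite innerE; do 2!apply: sumr_ge0 => ? _; rewrite -expr2 sqr_ge0.
Qed.

Lemma inner_eq0 p q (A : 'M[R]_(p, q)) : inner A A = 0 -> A = 0.
Proof.
rewrite innerE pair_bigA /= => /eqP.
rewrite psumr_eq0 => [/allP A0|i _]; last by rewrite -expr2 sqr_ge0.
apply/matrixP => i j; rewrite mxE; apply/eqP.
by have := A0 (i, j) (mem_index_enum _); rewrite /= -expr2 sqrf_eq0.
Qed.

Lemma inner_delta p q (i : 'I_p) (j : 'I_q) (A : 'M[R]_(p, q)) :
  inner (delta_mx i j) A = A i j.
Proof.
rewrite innerE (bigD1 i)//= (bigD1 j)//= !mxE !eqxx mul1r.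
rewrite !big1 ?addr0// => [k ki|k kj]; last by rewrite mxE (negPf kj) andbF mul0r.
by rewrite big1// => l _; rewrite mxE (negPf ki) mul0r.
Qed.

Lemma inner_sub_sqr p q (A B : 'M[R]_(p, q)) :
  inner (A - B) (A - B) = inner A A + inner B B - 2 * inner A B.
Proof. by rewrite innerBl !innerBr (innerC B A); ring. Qed.

Lemma normF_ge0 p q (A : 'M[R]_(p, q)) : 0 <= normF A.
Proof. exact: sqrtr_ge0. Qed.

Lemma entry_le_normF p q (A : 'M[R]_(p, q)) i j : `|A i j| <= normF A.
Proof.
rewrite -[leLHS]sqrtr_sqr ler_wsqrtr// innerE (bigD1 i)//= (bigD1 j)//=.
rewrite -expr2 -addrA lerDl addr_ge0// ?sumr_ge0// => [k _|k _].
  by rewrite -expr2 sqr_ge0.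
by apply: sumr_ge0 => l _; rewrite -expr2 sqr_ge0.
Qed.

End InnerProduct.

Section Orthogonal.
Context {R : realType}.

Definition orthogonal_mx p (U : 'M[R]_p) := U^T *m U = 1%:M.

Lemma orthogonal_mxV p (U : 'M[R]_p) : orthogonal_mx U -> U *m U^T = 1%:M.
Proof. exact: mulmx1C. Qed.

Lemma orthogonal_mx1 p : orthogonal_mx (1%:M : 'M[R]_p).
Proof. by rewrite /orthogonal_mx trmx1 mulmx1. Qed.

Lemma orthogonal_mxM p (U V : 'M[R]_p) :
  orthogonal_mx U -> orthogonal_mx V -> orthogonal_mx (U *m V).
Proof.
by rewrite /orthogonal_mx trmx_mul => UU VV; rewrite mulmxA -(mulmxA V^T) UU mulmx1.
Qed.

Lemma orthogonal_mxT p (U : 'M[R]_p) : orthogonal_mx U -> orthogonal_mx U^T.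
Proof. by move=> UU; rewrite /orthogonal_mx trmxK; exact: orthogonal_mxV. Qed.

Lemma inner_orthogonal p q (U : 'M[R]_p) (V : 'M[R]_q) A B :
  orthogonal_mx U -> orthogonal_mx V ->
  inner (U *m A *m V) (U *m B *m V) = inner A B.
Proof.
move=> UU VV; rewrite inner_mulr inner_mull -(mulmxA _ V) orthogonal_mxV//.
by rewrite mulmx1 mulmxA UU mul1mx.
Qed.

Lemma orthogonal_entry_le1 p (U : 'M[R]_p) i j : orthogonal_mx U -> `|U i j| <= 1.
Proof.
move=> UU; have /matrixP/(_ j j) := UU; rewrite !mxE eqxx mulr1n (bigD1 i)//= mxE.
rewrite -expr2 => eq1; rewrite -[`|_|]sqrtr_sqr -[leRHS]sqrtr1 ler_wsqrtr//.
by rewrite -eq1 lerDl sumr_ge0// => k _; rewrite mxE -expr2 sqr_ge0.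
Qed.

(** The Cayley transform [2 M - 1], with [M] the resolvent
    [(1 - (t/2) A)^-1], is an orthogonal curve tangent to a skew [A]; unlike the
    exponential it comes with exact algebraic expansions. *)
Definition cayley_res p (A : 'M[R]_p) (t : R) := invmx (1%:M - (t / 2) *: A).

Definition cayley p (A : 'M[R]_p) (t : R) := cayley_res A t *+ 2 - 1%:M.

Context {p : nat} (A : 'M[R]_p).
Hypothesis skewA : A^T = - A.

Lemma cayley_unit t : 1%:M - (t / 2) *: A \in unitmx.
Proof.
set s := t / 2; rewrite -row_free_unit -kermx_eq0; apply/eqP.
set K := kermx _; have : K *m (1%:M - s *: A) = 0 by exact: mulmx_ker.
rewrite mulmxBr mulmx1 -scalemxAr => /eqP; rewrite subr_eq0 => /eqP eK.
apply: inner_eq0; rewrite {1}eK innerZl.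
(* [K A K^T] is skew, hence has zero trace. *)
suff -> : inner (K *m A) K = 0 by rewrite mulr0.
have : inner (K *m A) K = - inner (K *m A) K.
  by rewrite {1}inner_mulr skewA mulmxN innerNr innerC.
by lra.
Qed.

Lemma cayley_resV t : (1%:M - (t / 2) *: A) *m cayley_res A t = 1%:M.
Proof. exact/mulmxV/cayley_unit. Qed.

Lemma cayley_Vres t : cayley_res A t *m (1%:M - (t / 2) *: A) = 1%:M.
Proof. exact/mulVmx/cayley_unit. Qed.

Lemma cayley_resE t : cayley_res A t = 1%:M + (t / 2) *: (A *m cayley_res A t).
Proof.
have := cayley_resV t; rewrite mulmxBl mul1mx -scalemxAl => /eqP.
by rewrite subr_eq => /eqP.
Qed.

Lemma cayleyE t : cayley A t = 1%:M + t *: (A *m cayley_res A t).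
Proof.
rewrite /cayley {1}cayley_resE; set P := A *m _.
by apply/matrixP => i j; rewrite !mxE; field.
Qed.

Lemma cayley_orthogonal t : orthogonal_mx (cayley A t).
Proof.
have M1 := cayley_resV t; have := congr1 trmx M1.
rewrite trmx_mul linearB/= linearZ/= skewA trmx1 scalerN opprK => MT1.
set M := cayley_res A t in M1 MT1 *.
(* Orthogonality of [2 M - 1] amounts to this identity. *)
have sumM : M^T + M = (M^T *m M) *+ 2.
  have {1}-> : M^T = M^T *m ((1%:M - (t / 2) *: A) *m M) by rewrite M1 mulmx1.
  have {3}-> : M = M^T *m (1%:M + (t / 2) *: A) *m M by rewrite MT1 mul1mx.
  rewrite -[_ *m _ *m M]mulmxA -mulmxDr -mulmxDl addrACA addNr addr0.
  by rewrite mulmxDl !mul1mx mulmxDr mulr2n.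
have CT : (cayley A t)^T = M^T + M^T - 1%:M.
  by rewrite /cayley -/M mulr2n; apply/matrixP => i j; rewrite !mxE eq_sym.
rewrite /orthogonal_mx CT /cayley -/M mulr2n.
rewrite !mulmxBr !mulmxBl !mulmxDl !mulmxDr !mulmx1 !mul1mx.
apply/matrixP => i j; have /matrixP/(_ i j) := sumM.
by rewrite mulr2n !mxE; lra.
Qed.

End Orthogonal.

(** * Matrix limits and compactness of stabilizers *)

Section MatrixLimits.
Context {R : realType} {T : Type} {F : set_system T} {FF : Filter F}.

Lemma cvg_mxP p q (f : T -> 'M[R]_(p, q)) (L : 'M[R]_(p, q)) :
  (forall i j, f x i j @[x --> F] --> L i j) <-> f x @[x --> F] --> L.
Proof.
split=> [fL A [P nP PA]|fL i j]; last first.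
  exact: (cvg_comp f (fun M : 'M[R]_(p, q) => M i j) fL (@coord_continuous _ _ _ i j L)).
suff : \forall x \near F, forall ij : 'I_p * 'I_q, P ij.1 ij.2 (f x ij.1 ij.2).
  by apply: filterS => x Px; apply: PA => i j; exact: (Px (i, j)).
by apply: filter_forall => -[i j]; apply: fL; exact: nP.
Qed.

Lemma cvg_mx_add p q (f g : T -> 'M[R]_(p, q)) (A B : 'M[R]_(p, q)) :
  f x @[x --> F] --> A -> g x @[x --> F] --> B ->
  (f x + g x) @[x --> F] --> A + B.
Proof. exact: cvgD. Qed.

Lemma cvg_mx_sub p q (f g : T -> 'M[R]_(p, q)) (A B : 'M[R]_(p, q)) :
  f x @[x --> F] --> A -> g x @[x --> F] --> B ->
  (f x - g x) @[x --> F] --> A - B.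
Proof. exact: cvgB. Qed.

Lemma cvg_mulmx p q r (f : T -> 'M[R]_(p, q)) (g : T -> 'M[R]_(q, r))
    (A : 'M[R]_(p, q)) (B : 'M[R]_(q, r)) :
  f x @[x --> F] --> A -> g x @[x --> F] --> B ->
  f x *m g x @[x --> F] --> A *m B.
Proof.
move=> /cvg_mxP fA /cvg_mxP gB; apply/cvg_mxP => i j; rewrite mxE.
under eq_cvg do rewrite mxE.
by apply: cvg_big => [|k _]; [exact: add_continuous|exact: cvgM].
Qed.

Lemma cvg_inner p q (f g : T -> 'M[R]_(p, q)) (A B : 'M[R]_(p, q)) :
  f x @[x --> F] --> A -> g x @[x --> F] --> B ->
  inner (f x) (g x) @[x --> F] --> inner A B.
Proof.
move=> /cvg_mxP fA /cvg_mxP gB; rewrite innerE.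
under eq_cvg do rewrite innerE.
apply: cvg_big => [|i _]; first exact: add_continuous.
by apply: cvg_big => [|j _]; [exact: add_continuous|exact: cvgM].
Qed.

Lemma cvg_trmx p q (f : T -> 'M[R]_(p, q)) (A : 'M[R]_(p, q)) :
  f x @[x --> F] --> A -> (f x)^T @[x --> F] --> A^T.
Proof.
move=> /cvg_mxP fA; apply/cvg_mxP => i j; rewrite mxE.
under eq_cvg do rewrite mxE.
exact: fA.
Qed.

Lemma cvg_normF0 p q (f : T -> 'M[R]_(p, q)) (A : 'M[R]_(p, q)) :
  f x @[x --> F] --> A <-> normF (f x - A) @[x --> F] --> (0 : R).
Proof.
split=> [fA|nA].
  rewrite -(sqrtr0 R) -[X in Num.sqrt X](inner0r (0 : 'M[R]_(p, q))) -(subrr A).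
  apply: (cvg_comp (fun x => inner (f x - A) (f x - A)) Num.sqrt); last exact: sqrt_continuous.
  by apply: cvg_inner; apply: cvgB => //; exact: cvg_cst.
apply/cvg_mxP => i j; apply/cvgrPdist_lt => e e0.
move/cvgrPdist_lt/(_ e e0): nA; apply: filterS => x.
rewrite sub0r normrN ger0_norm ?normF_ge0//; apply: le_lt_trans.
by rewrite distrC; apply: le_trans (entry_le_normF _ i j); rewrite !mxE.
Qed.

End MatrixLimits.

Section Stabilizer.
Context {R : realType}.

(** The group of pairs of orthogonal matrices fixing [Z] is compact, hence the
    linear functional [<C, U^T W V>] attains its maximum on it. *)
Lemma stabilizer_argmax p q (Z C W : 'M[R]_(p, q)) :
  exists U V, [/\ orthogonal_mx U, orthogonal_mx V, U *m Z = Z *m V &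
    forall U' V', orthogonal_mx U' -> orthogonal_mx V' -> U' *m Z = Z *m V' ->
      inner C (U'^T *m W *m V') <= inner C (U^T *m W *m V)].
Proof.
pose N := (p * p + q * q)%N.
pose Lu (v : 'rV[R]_N) : 'M[R]_p := vec_mx (lsubmx v).
pose Ru (v : 'rV[R]_N) : 'M[R]_q := vec_mx (rsubmx v).
have cL v : Lu u @[u --> v] --> Lu v.
  apply/(@cvg_mxP R _ (nbhs v)) => i j; rewrite /Lu !mxE; under eq_cvg do rewrite !mxE.
  exact: coord_continuous.
have cR v : Ru u @[u --> v] --> Ru v.
  apply/(@cvg_mxP R _ (nbhs v)) => i j; rewrite /Ru !mxE; under eq_cvg do rewrite !mxE.
  exact: coord_continuous.
have closed0 r s (G : 'rV[R]_N -> 'M[R]_(r, s)) :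
    (forall v, G u @[u --> v] --> G v) -> closed [set v | G v = 0].
  move=> cG; have -> : [set v | G v = 0] = (fun v => inner (G v) (G v)) @^-1` [set 0].
    apply/seteqP; split=> v /=; last exact: inner_eq0.
    by move=> ->; rewrite inner0r.
  apply: (continuous_closedP _).1 => [v|]; last exact: closed_eq.
  exact: (@cvg_inner R _ (nbhs v) _ _ _ G G _ _ (cG v) (cG v)).
(* Pairs of matrices are encoded as row vectors, where a product of compact
   intervals is compact. *)
pose K := [set v | (Lu v)^T *m Lu v - 1%:M = 0] `&`
  ([set v | (Ru v)^T *m Ru v - 1%:M = 0] `&` [set v | Lu v *m Z - Z *m Ru v = 0]).
have KP v : K v <-> [/\ orthogonal_mx (Lu v), orthogonal_mx (Ru v) &
    Lu v *m Z = Z *m Ru v].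
  by rewrite /K /=; split=> [[/subr0_eq a [/subr0_eq b /subr0_eq c]]|[-> -> ->]];
    rewrite ?subrr.
have cK : closed K.
  apply: closedI; last apply: closedI; apply: closed0 => v; apply: (@cvg_mx_sub R _ (nbhs v)).
  - exact: (cvg_mulmx (cvg_trmx (cL v)) (cL v)).
  - exact: cvg_cst.
  - exact: (cvg_mulmx (cvg_trmx (cR v)) (cR v)).
  - exact: cvg_cst.
  - exact: (cvg_mulmx (cL v) (cvg_cst Z)).
  - exact: (cvg_mulmx (cvg_cst Z) (cR v)).
have K_compact : compact K.
  apply: (subclosed_compact cK (rV_compact (fun=> @segment_compact R (-1) 1))).
  move=> v /KP[UU VV _] k /=; rewrite in_itv/= -ler_norml.
  case: (splitP k) => [l kl|l kl].
    have -> : k = lshift _ l by apply: val_inj.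
    case/mxvec_indexP: l {kl} => i j.
    by have := orthogonal_entry_le1 i j UU; rewrite !mxE.
  have -> : k = rshift _ l by apply: val_inj.
  case/mxvec_indexP: l {kl} => i j.
  by have := orthogonal_entry_le1 i j VV; rewrite !mxE.
pose pair (U : 'M[R]_p) (V : 'M[R]_q) : 'rV[R]_N := row_mx (mxvec U) (mxvec V).
have pairL U V : Lu (pair U V) = U by rewrite /Lu row_mxKl mxvecK.
have pairR U V : Ru (pair U V) = V by rewrite /Ru row_mxKr mxvecK.
have K0 : K !=set0.
  exists (pair 1%:M 1%:M); apply/KP; rewrite pairL pairR mul1mx mulmx1.
  by split=> //; exact: orthogonal_mx1.
have [v|v vK vmax] := @compact_EVT_max _ R
    (fun v => inner C ((Lu v)^T *m W *m Ru v)) K K0 K_compact.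
  apply: continuous_subspaceT => {}v.
  exact: (cvg_inner (cvg_cst C)
    (cvg_mulmx (cvg_mulmx (cvg_trmx (cL v)) (cvg_cst W)) (cR v))).
have /KP[UU VV UZ] := set_mem vK.
exists (Lu v), (Ru v); split=> // U' V' U'U' V'V' U'Z.
have := vmax (pair U' V'); rewrite pairL pairR; apply.
by apply/mem_set/KP; rewrite pairL pairR.
Qed.

End Stabilizer.

(** * Cayley curves and first-order optimality *)

Section CayleyLimits.
Context {R : realType} {p : nat} (A : 'M[R]_p).
Hypothesis skewA : A^T = - A.
Context {T : Type} {F : set_system T} {FF : Filter F} (t : T -> R).
Hypothesis t0 : t x @[x --> F] --> (0 : R).

(** [M = (C + 1) / 2] with [C] orthogonal; with [M = 1 + (t/2) A M] this bound
    gives [M --> 1]. *)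
Lemma cayley_res_entry_le1 (s : R) i j : `|cayley_res A s i j| <= 1.
Proof.
have := orthogonal_entry_le1 i j (cayley_orthogonal skewA s).
rewrite /cayley mulr2n !mxE.
case: (i == j) => /=; rewrite ?mulr1n ?mulr0n !ler_norml; lra.
Qed.

Lemma cvg_cayley_res : cayley_res A (t x) @[x --> F] --> (1%:M : 'M[R]_p).
Proof.
apply/cvg_mxP => i j; apply/cvgrPdist_le => e e0.
pose K := \sum_k `|A i k|; have K0 : 0 <= K by exact: sumr_ge0.
have d0 : 0 < e / (K + 1) by rewrite divr_gt0// ltr_wpDl.
move/cvgrPdist_le/(_ _ d0): t0; apply: filterS => x; rewrite sub0r normrN => tx.
rewrite cayley_resE// !mxE opprD addNKr normrN normrM normf_div.
have sK : `|\sum_k A i k * cayley_res A (t x) k j| <= K.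
  apply: le_trans (ler_norm_sum _ _ _) _; apply: ler_sum => k _.
  by rewrite normrM ler_piMr// cayley_res_entry_le1.
have t2 : `|t x| / `|2| <= `|t x|.
  by rewrite (ger0_norm (ler0n _ 2)) ler_pdivrMr// ler_peMr// ler1n.
apply: (@le_trans _ _ (`|t x| * K)); first by apply: ler_pM.
apply: (@le_trans _ _ (e / (K + 1) * K)); first by apply: ler_wpM2r.
rewrite mulrAC ler_pdivrMr ?ltr_wpDl// ler_wpM2l ?(ltW e0)//.
by rewrite lerDl.
Qed.

Lemma cvg_cayley_der : A *m cayley_res A (t x) @[x --> F] --> A.
Proof. by have := cvg_mulmx (cvg_cst A) cvg_cayley_res; rewrite mulmx1; exact. Qed.

End CayleyLimits.

Section Stationarity.
Context {R : realType}.

(** A skew pair with [A Z = Z B] generates, through its Cayley transforms, a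
    curve inside the stabilizer of [Z]. *)
Lemma cayley_stabilizes p q (A : 'M[R]_p) (B : 'M[R]_q) (Z : 'M[R]_(p, q)) t :
  A^T = - A -> B^T = - B -> A *m Z = Z *m B ->
  cayley A t *m Z = Z *m cayley B t.
Proof.
move=> skA skB AZ; rewrite /cayley mulmxBl mulmxBr mul1mx mulmx1; congr (_ - _).
rewrite !mulr2n mulmxDl mulmxDr; congr (_ + _); rewrite -?mulr2n.
all: rewrite -[Z in LHS]mulmx1 -(cayley_resV skB t) !mulmxA; congr (_ *m _).
all: rewrite -mulmxA mulmxBr mulmx1 -scalemxAr -AZ scalemxAl.
all: by rewrite -{1}[Z]mul1mx -mulmxBl mulmxA cayley_Vres// mul1mx.
Qed.

(** First-order optimality at a maximizer over the stabilizer of [Z]: move along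
    Cayley curves of [(A, B)] and of [(- A, - B)]. *)
Lemma stabilizer_stationary p q (Z C W : 'M[R]_(p, q)) :
  (forall U V, orthogonal_mx U -> orthogonal_mx V -> U *m Z = Z *m V ->
    inner C (U^T *m W *m V) <= inner C W) ->
  forall A B, A^T = - A -> B^T = - B -> A *m Z = Z *m B ->
    inner C (A *m W) = inner C (W *m B).
Proof.
move=> Wmax.
have half A B : A^T = - A -> B^T = - B -> A *m Z = Z *m B ->
    inner C (W *m B) <= inner C (A *m W).
  move=> skA skB AZ.
  pose P t := (A *m cayley_res A t)^T; pose Q t := B *m cayley_res B t.
  have id_right : x @[x --> (0 : R)^'+] --> (0 : R) by exact: cvg_at_right_filter cvg_id.
  have cP : P t @[t --> (0 : R)^'+] --> - A.
    by rewrite -skA; apply: cvg_trmx; exact: cvg_cayley_der.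
  have cQ : Q t @[t --> (0 : R)^'+] --> B by exact: cvg_cayley_der.
  have lim : inner C (P t *m W + W *m Q t + t *: (P t *m W *m Q t))
      @[t --> (0 : R)^'+] --> inner C (- A *m W + W *m B + 0 *: (- A *m W *m B)).
    apply: cvg_inner; first exact: cvg_cst.
    apply: cvg_mx_add.
      by apply: cvg_mx_add; apply: cvg_mulmx => //; exact: cvg_cst.
    apply: cvgZ => //; apply: cvg_mulmx => //.
    by apply: cvg_mulmx => //; exact: cvg_cst.
  have : inner C (- A *m W + W *m B + 0 *: (- A *m W *m B)) <= 0.
    apply: (cvgr_to_le lim); near=> t.
    have tgt0 : 0 < t by near: t; exact: nbhs_right_gt.
    have := Wmax _ _ (cayley_orthogonal skA t) (cayley_orthogonal skB t)
      (cayley_stabilizes t skA skB AZ).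
    have trE r (S : 'M[R]_r) : (1%:M + t *: S)^T = 1%:M + t *: S^T.
      by rewrite linearD/= linearZ/= trmx1.
    rewrite !cayleyE// trE -/(P t) -/(Q t).
    have -> : (1%:M + t *: P t) *m W *m (1%:M + t *: Q t) =
        W + t *: (P t *m W + W *m Q t + t *: (P t *m W *m Q t)).
      rewrite mulmxDl mul1mx mulmxDr !mulmx1 mulmxDl -!scalemxAl -!scalemxAr.
      by rewrite !scalerDr !scalerA !addrA.
    by rewrite innerDr innerZr gerDl pmulr_rle0.
  by rewrite scale0r addr0 innerDr mulNmx innerNr addrC subr_le0.
move=> A B skA skB AZ; apply/eqP; rewrite eq_le; apply/andP; split.
  have skewN r (S : 'M[R]_r) : S^T = - S -> (- S)^T = - - S.
    by move=> skS; rewrite linearN/= skS.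
  have NAZ : - A *m Z = Z *m - B by rewrite mulNmx mulmxN AZ.
  have := half _ _ (skewN _ _ skA) (skewN _ _ skB) NAZ.
  by rewrite mulNmx mulmxN !innerNr lerN2.
exact: half.
Unshelve. all: by end_near. Qed.

End Stationarity.

(** * Rectangular diagonal matrices *)

Section RectangularDiagonal.
Context {R : realType} {m n : nat}.

Definition rdiag (x : 'cV[R]_n) : 'M[R]_(m, n) :=
  \matrix_(i, j) (x j 0 *+ (i == j :> nat)).

Lemma rdiagD x y : rdiag (x + y) = rdiag x + rdiag y.
Proof. by apply/matrixP => i j; rewrite !mxE mulrnDl. Qed.

Lemma rdiagZ a x : rdiag (a *: x) = a *: rdiag x.
Proof. by apply/matrixP => i j; rewrite !mxE mulrnAr. Qed.

Lemma rdiagB x y : rdiag (x - y) = rdiag x - rdiag y.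
Proof. by rewrite rdiagD -scaleN1r rdiagZ scaleN1r. Qed.

Lemma rdiag0 : rdiag 0 = 0.
Proof. by apply/matrixP => i j; rewrite !mxE mul0rn. Qed.

Lemma rdiag_sum (I : finType) (x : I -> 'cV[R]_n) :
  rdiag (\sum_i x i) = \sum_i rdiag (x i).
Proof. by elim/big_rec2: _ => [|i y z _ <-]; rewrite ?rdiag0 ?rdiagD. Qed.

Hypothesis lenm : (n <= m)%N.

Definition embed : 'I_n -> 'I_m := widen_ord lenm.

Lemma embed_inj : injective embed.
Proof. by move=> i j /(congr1 val)/= /val_inj. Qed.

Lemma embed_ltn k : (embed k < n)%N.
Proof. exact: (ltn_ord k). Qed.

Lemma embedP (a : 'I_m) : (exists k, a = embed k) \/ (n <= a)%N.
Proof.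
case: (ltnP a n) => [an|]; last by right.
by left; exists (Ordinal an); apply: val_inj.
Qed.

Lemma rdiag_embed x i j : rdiag x (embed i) j = x j 0 *+ (i == j).
Proof. by rewrite mxE. Qed.

Lemma rdiag_low x (a : 'I_m) j : (n <= a)%N -> rdiag x a j = 0.
Proof. by move=> na; rewrite mxE gtn_eqF// (leq_trans _ na). Qed.

Lemma mulmx_rdiag p (A : 'M[R]_(p, m)) x i j :
  (A *m rdiag x) i j = A i (embed j) * x j 0.
Proof.
rewrite mxE (bigD1 (embed j))//= mxE eqxx mulr1n big1 ?addr0// => k kj.
by rewrite mxE -[_ == _]/(k == embed j) (negPf kj) mulr0.
Qed.

Lemma rdiag_mulmx q (B : 'M[R]_(n, q)) x k j :
  (rdiag x *m B) (embed k) j = x k 0 * B k j.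
Proof.
rewrite mxE (bigD1 k)//= rdiag_embed eqxx mulr1n big1 ?addr0// => l lk.
by rewrite rdiag_embed eq_sym (negPf lk) mul0r.
Qed.

Lemma rdiag_mulmx_low q (B : 'M[R]_(n, q)) x (a : 'I_m) j : (n <= a)%N ->
  (rdiag x *m B) a j = 0.
Proof. by move=> na; rewrite mxE big1// => k _; rewrite rdiag_low// mul0r. Qed.

Lemma tr_rdiag_mulmx q (B : 'M[R]_(m, q)) x k j :
  ((rdiag x)^T *m B) k j = x k 0 * B (embed k) j.
Proof.
rewrite mxE (bigD1 (embed k))//= mxE rdiag_embed eqxx mulr1n big1 ?addr0//.
by move=> a ak; rewrite !mxE -[_ == _]/(a == embed k) (negPf ak) mul0r.
Qed.

Lemma inner_rdiagl x (M : 'M[R]_(m, n)) :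
  inner (rdiag x) M = \sum_j x j 0 * M (embed j) j.
Proof. by rewrite /inner /mxtrace; apply: eq_bigr => j _; rewrite tr_rdiag_mulmx. Qed.

Lemma inner_rdiag x y : inner (rdiag x) (rdiag y) = inner x y.
Proof.
rewrite inner_rdiagl innerE; apply: eq_bigr => j _.
by rewrite big_ord1 rdiag_embed eqxx.
Qed.

Lemma skew_diag0 p (A : 'M[R]_p) i : A^T = - A -> A i i = 0.
Proof. by move=> /matrixP/(_ i i); rewrite !mxE; lra. Qed.

(** The tangent vectors [A Dx - Dx B] to the orbit of [Dx] have zero diagonal,
    since skew matrices do. *)
Lemma inner_rdiag_tangent x y (A : 'M[R]_m) (B : 'M[R]_n) :
  A^T = - A -> B^T = - B ->
  inner (rdiag y) (A *m rdiag x - rdiag x *m B) = 0.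
Proof.
move=> skA skB; rewrite inner_rdiagl big1// => j _.
have subE (M N : 'M[R]_(m, n)) a b : (M - N) a b = M a b - N a b by rewrite !mxE.
by rewrite subE mulmx_rdiag rdiag_mulmx !skew_diag0//; ring.
Qed.

End RectangularDiagonal.

(** * Frames adapted to a direction *)

Section AdaptedFrame.
Context {R : realType} {m n : nat} (lenm : (n <= m)%N).
Local Notation emb := (embed lenm).
Local Notation D := (@rdiag R m n).

Section Stationary.
Context (c x : 'cV[R]_n) (W : 'M[R]_(m, n)).
Hypothesis c_gt0 : forall i, 0 < c i 0.
Hypothesis c_inj : forall i j, i != j -> c i 0 != c j 0.
Hypothesis x_ge0 : forall i, 0 <= x i 0.
Hypothesis stationary : forall A B, A^T = - A -> B^T = - B ->
  A *m D x = D x *m B -> inner (D c) (A *m W) = inner (D c) (W *m B).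

Let skew_delta p (a b : 'I_p) : 'M[R]_p := delta_mx a b - delta_mx b a.

Let skew_deltaT p (a b : 'I_p) : (skew_delta a b)^T = - skew_delta a b.
Proof. by rewrite linearB/= !trmx_delta opprB. Qed.

Let subE p q (M N : 'M[R]_(p, q)) a b : (M - N) a b = M a b - N a b.
Proof. by rewrite !mxE. Qed.

Let inner_skew_deltal (a b : 'I_m) :
  inner (D c) (skew_delta a b *m W) = (D c *m W^T) a b - (D c *m W^T) b a.
Proof.
by rewrite innerC inner_mulr innerBl !inner_delta.
Qed.

Let inner_skew_deltar (i j : 'I_n) :
  inner (D c) (W *m skew_delta i j) = c j 0 * W (emb j) i - c i 0 * W (emb i) j.
Proof.
rewrite innerC inner_mull innerBl !inner_delta -[W^T *m D c]trmxK trmx_mul trmxK.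
by rewrite !(mxE trmx_key) !(tr_rdiag_mulmx lenm).
Qed.

(** Optimality along the rotation of the coordinates [i] and [j] on both sides. *)
Let antisym_ties i j : i != j -> x i 0 = x j 0 -> W (emb i) j + W (emb j) i = 0.
Proof.
move=> ij xij; pose A := skew_delta (emb i) (emb j).
have AD : A *m D x = D x *m skew_delta i j.
  apply/matrixP => a b; rewrite mulmx_rdiag.
  have [[k ->]|na] := embedP lenm a.
    rewrite rdiag_mulmx !subE !mxE !(inj_eq (embed_inj (lenm := lenm))).
    case: (eqVneq k i) => ki; case: (eqVneq k j) => kj;
      case: (eqVneq b i) => bi; case: (eqVneq b j) => bj;
      rewrite /= ?ki ?kj ?bi ?bj ?xij; ring.
  have ne k : (a == emb k) = false.
    by apply/eqP => ak; move: na; rewrite ak leqNgt embed_ltn.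
  by rewrite rdiag_mulmx_low// subE !mxE !ne/= subrr mul0r.
have := stationary (skew_deltaT _ _) (skew_deltaT _ _) AD.
rewrite inner_skew_deltal inner_skew_deltar !rdiag_mulmx !mxE => e.
have : (c i 0 - c j 0) * (W (emb i) j + W (emb j) i) = 0 by lra.
by move/eqP; rewrite mulf_eq0 subr_eq0 (negPf (c_inj ij))/= => /eqP.
Qed.

(** Where [x] vanishes, the left factor alone may rotate; together with the
   previous relation this leaves only the zero entry. *)
Let zero_rows (a : 'I_m) j : a != emb j -> (forall k, a = emb k -> x k 0 = 0) ->
  x j 0 = 0 -> W a j = 0.
Proof.
move=> aj xa xj; pose A := skew_delta a (emb j).
have AD : A *m D x = D x *m (0 : 'M[R]_n).
  rewrite mulmx0; apply/matrixP => b k; rewrite mulmx_rdiag subE !mxE.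
  have [/eqP|_] := eqVneq (emb k) (emb j).
    by rewrite (inj_eq (embed_inj (lenm := lenm))) => /eqP ->; rewrite xj mulr0.
  have [/esym/xa ->|_] := eqVneq (emb k) a; first by rewrite mulr0.
  by rewrite !andbF subrr mul0r.
have skew0 : (0 : 'M[R]_n)^T = - 0 by rewrite trmx0 oppr0.
have := stationary (skew_deltaT _ _) skew0 AD.
rewrite inner_skew_deltal mulmx0 inner0r => e.
have [[k ak]|na] := embedP lenm a; last first.
  move: e; rewrite rdiag_mulmx_low// rdiag_mulmx mxE sub0r => /eqP; rewrite oppr_eq0 mulf_eq0.
  by rewrite gt_eqF//= => /eqP.
have kj : k != j by apply: contraNneq aj => <-; rewrite ak.
have := antisym_ties kj; rewrite (xa _ ak) xj => /(_ erefl).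
move=> e2; have W_jk : W (emb j) k = - W (emb k) j by lra.
move: e; rewrite ak !rdiag_mulmx !mxE W_jk => e1.
have : (c k 0 + c j 0) * W (emb k) j = 0 by lra.
by move/eqP; rewrite mulf_eq0 gt_eqF ?addr_gt0//= => /eqP.
Qed.

(** Off the ties of [x] the matrix [A Dx - Dx B] takes arbitrary values, by a 2
    by 2 linear system with determinant [x_j^2 - x_i^2]; on the ties the
    stationarity of [W] kills what is out of reach. *)
Lemma stationary_decomposition : exists A B, [/\ A^T = - A, B^T = - B &
  W = D (\col_i W (emb i) i) + (A *m D x - D x *m B)].
Proof.
(* [y] and [V] extend [x] and [W] by zero to the indices up to [m], so that one
   formula defines [A]; where [y a = y b = 0] it gives 0, as [z / 0 = 0]. *)
pose y (a : 'I_m) := oapp (fun k : 'I_n => x k 0) 0 (insub (val a)).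
pose V (a b : 'I_m) := oapp (fun k : 'I_n => W a k) 0 (insub (val b)).
have insub_emb k : insub (val (emb k)) = Some k :> option 'I_n by rewrite valK.
have yE k : y (emb k) = x k 0 by rewrite /y insub_emb.
have VE a k : V a (emb k) = W a k by rewrite /V insub_emb.
have y_low (a : 'I_m) : (n <= a)%N -> y a = 0 by move=> na; rewrite /y insubF// ltnNge na.
have V_low a (b : 'I_m) : (n <= b)%N -> V a b = 0.
  by move=> nb; rewrite /V insubF// ltnNge nb.
pose A : 'M[R]_m := \matrix_(a, b) if y a == y b then (V a b - V b a) / (2 * y a)
  else (y b * V a b + y a * V b a) / (y b ^+ 2 - y a ^+ 2).
pose B : 'M[R]_n := \matrix_(i, j) if x i 0 == x j 0 then 0
  else (x i 0 * W (emb i) j + x j 0 * W (emb j) i) / (x j 0 ^+ 2 - x i 0 ^+ 2).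
exists A, B; split.
- apply/matrixP => a b; rewrite !mxE (eq_sym (y b)).
  case: eqVneq => [->|_]; first by rewrite -mulNr opprB.
  by rewrite -[RHS]mulrN -invrN opprB addrC.
- apply/matrixP => i j; rewrite !mxE (eq_sym (x j 0)).
  case: eqVneq => [_|_]; first by rewrite oppr0.
  by rewrite -[RHS]mulrN -invrN opprB addrC.
apply/matrixP => a j.
have addE (M N : 'M[R]_(m, n)) : (M + N) a j = M a j + N a j by rewrite !mxE.
have AE b k : A b (emb k) = if y b == x k 0 then (W b k - V (emb k) b) / (2 * y b)
    else (x k 0 * W b k + y b * V (emb k) b) / (x k 0 ^+ 2 - y b ^+ 2).
  by rewrite mxE yE VE.
rewrite addE subE mulmx_rdiag AE.
have [[k ->]|na] := embedP lenm a; last first.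
  rewrite rdiag_low// rdiag_mulmx_low// y_low// V_low// subr0 add0r.
  have [xj|xj] := eqVneq 0 (x j 0).
    rewrite -xj mulr0; apply: zero_rows => //.
      by apply: contraTneq na => ->; rewrite -ltnNge embed_ltn.
    by move=> k ak; move: na; rewrite ak leqNgt embed_ltn.
  by field; rewrite eq_sym.
rewrite rdiag_embed rdiag_mulmx !mxE !yE !VE.
have [kj|kj] := eqVneq k j.
  by rewrite kj eqxx subrr mul0r mul0r mulr0 subr0 addr0 mulr1n.
rewrite mulr0n add0r; have [xkj|xkj] := eqVneq (x k 0) (x j 0).
  have W0 := antisym_ties kj xkj; rewrite xkj mulr0 subr0.
  have [xj0|xj0] := eqVneq (x j 0) 0; last first.
    have -> : W (emb j) k = - W (emb k) j by lra.
    by field.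
  rewrite xj0 mulr0; apply: zero_rows => //.
  by move=> l /embed_inj <-; rewrite xkj.
have d0 : x j 0 ^+ 2 - x k 0 ^+ 2 != 0.
  rewrite subr_eq0; apply: contra xkj => /eqP e.
  by rewrite eq_sym -(eqrXn2 (n := 2))//; apply/eqP.
by field.
Qed.

End Stationary.

(** Simultaneous transpositions of rows and columns yield the order of the
    diagonal of an optimal frame inside the ties of [x]. *)
Lemma inner_swap (W : 'M[R]_(m, n)) (c : 'cV[R]_n) i j : i != j ->
  let U := perm_mx (tperm (emb i) (emb j)) in let V := perm_mx (tperm i j) in
  inner (D c) (U^T *m W *m V) = inner (D c) W -
    (c i 0 - c j 0) * (W (emb i) i - W (emb j) j).
Proof.
move=> ij /=; rewrite tr_perm_mx tpermV -row_permE -(tpermV i j) -col_permE.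
rewrite !inner_rdiagl (bigD1 i)//= (bigD1 j) 1?eq_sym//= [in RHS](bigD1 i)//=.
rewrite [in RHS](bigD1 j) 1?eq_sym//= !mxE -!inj_tperm; do ?exact: embed_inj.
rewrite tpermL tpermR.
rewrite (eq_bigr (fun k => c k 0 * W (emb k) k)); first by ring.
move=> k /andP[ki kj]; rewrite !mxE -inj_tperm; last exact: embed_inj.
by rewrite tpermD// eq_sym.
Qed.

Lemma swap_stabilizes (x : 'cV[R]_n) i j : x i 0 = x j 0 ->
  perm_mx (tperm (emb i) (emb j)) *m D x = D x *m perm_mx (tperm i j).
Proof.
move=> xij; rewrite -(tpermV i j) -row_permE -col_permE.
apply/matrixP => a k; rewrite !mxE.
suff -> : (tperm (emb i) (emb j) a == k :> nat) = (a == tperm i j k :> nat).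
  by case: tpermP => [->|->|//]; rewrite xij.
rewrite -[LHS]/(tperm (emb i) (emb j) a == emb k) -[RHS]/(a == emb (tperm i j k)).
rewrite inj_tperm; last exact: embed_inj.
by rewrite -(inj_eq (@perm_inj _ (tperm (emb i) (emb j)))) tpermK.
Qed.

Lemma perm_mx_orthogonal p (s : {perm 'I_p}) : orthogonal_mx (perm_mx s : 'M[R]_p).
Proof. by rewrite /orthogonal_mx tr_perm_mx -perm_mxM mulVg perm_mx1. Qed.

(** The frame maximizes [<Dc, U^T W V>] over the stabilizer of [Dx].  First-order
    optimality leaves a diagonal part and a vector tangent to the orbit of [Dx];
    comparison with the transpositions and reflections in the stabilizer orders
    the diagonal on the ties of [x] and makes it nonnegative where [x] vanishes,
    because the entries of [c] are decreasing and positive. *)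
Lemma adapted_frame (c x : 'cV[R]_n) (W : 'M[R]_(m, n)) :
  (forall i, 0 < c i 0) -> (forall i j : 'I_n, (i < j)%N -> c j 0 < c i 0) ->
  (forall i, 0 <= x i 0) ->
  exists U V w, [/\ orthogonal_mx U, orthogonal_mx V, U *m D x = D x *m V,
    exists A B, [/\ A^T = - A, B^T = - B &
      U^T *m W *m V = D w + (A *m D x - D x *m B)] &
    [/\ forall i j : 'I_n, (i <= j)%N -> x i 0 = x j 0 -> w j 0 <= w i 0,
      forall i, x i 0 = 0 -> 0 <= w i 0 &
      forall U' V', orthogonal_mx U' -> orthogonal_mx V' ->
        U' *m D x = D x *m V' -> inner (D c) (U'^T *m W *m V') <= inner c w]].
Proof.
move=> c_gt0 c_dec x_ge0.
have [U [V [UU VV UV UVmax]]] := stabilizer_argmax (D x) (D c) W.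
set W' := U^T *m W *m V in UVmax; exists U, V, (\col_i W' (emb i) i).
have W'max U' V' : orthogonal_mx U' -> orthogonal_mx V' -> U' *m D x = D x *m V' ->
    inner (D c) (U'^T *m W' *m V') <= inner (D c) W'.
  move=> U'U' V'V' U'V'; rewrite /W' !mulmxA -trmx_mul -mulmxA.
  apply: UVmax; [exact: orthogonal_mxM..|].
  by rewrite -mulmxA U'V' !mulmxA UV.
have inner_c M : inner (D c) M = inner c (\col_i M (emb i) i).
  rewrite (inner_rdiagl lenm) innerE; apply: eq_bigr => i _.
  by rewrite big_ord1 mxE.
have c_inj i j : i != j -> c i 0 != c j 0.
  move=> ij; have [ltij|ltji] : (i < j)%N \/ (j < i)%N.
    by apply/orP; rewrite -neq_ltn.
  - by rewrite gt_eqF// c_dec.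
  - by rewrite lt_eqF// c_dec.
split=> //; first exact: stationary_decomposition (stabilizer_stationary W'max).
split=> [i j|i xi0|U' V' U'U' V'V' U'V']; last by rewrite -inner_c; exact: UVmax.
- rewrite leq_eqVlt => /orP[/eqP/val_inj ->//|ltij] xij; rewrite mxE [leRHS]mxE.
  have ij : i != j by apply: contraTneq ltij => ->; rewrite ltnn.
  have := W'max _ _ (perm_mx_orthogonal _) (perm_mx_orthogonal _) (swap_stabilizes xij).
  rewrite inner_swap// gerBl pmulr_rge0 ?subr_gt0 ?c_dec//.
  by rewrite subr_ge0.
(* The reflection of one left coordinate changes the sign of [w i]. *)
- rewrite mxE; pose U' : 'M[R]_m := 1%:M - 2 *: delta_mx (emb i) (emb i).
  have U'T : U'^T = U' by rewrite linearB/= linearZ/= trmx1 trmx_delta.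
  have U'U' : orthogonal_mx U'.
    rewrite /orthogonal_mx U'T mulmxBl mul1mx mulmxBr mulmx1 -scalemxAl -scalemxAr.
    rewrite mul_delta_mx; apply/matrixP => a b; rewrite !mxE; ring.
  have dD : delta_mx (emb i) (emb i) *m D x = 0.
    apply/matrixP => a k; rewrite mulmx_rdiag !mxE (inj_eq (embed_inj (lenm := lenm))).
    have [->|_] := eqVneq k i; first by rewrite xi0 mulr0.
    by rewrite andbF mul0r.
  have U'D : U' *m D x = D x *m 1%:M.
    by rewrite mulmxBl mul1mx mulmx1 -scalemxAl dD scaler0 subr0.
  have := W'max _ _ U'U' (@orthogonal_mx1 _ _) U'D.
  rewrite mulmx1 U'T mulmxBl mul1mx -scalemxAl innerBr innerZr gerBl.
  rewrite innerC inner_mulr inner_delta rdiag_mulmx mxE pmulr_rge0//.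
  by rewrite pmulr_rge0.
Qed.

End AdaptedFrame.

(** * Von Neumann's trace inequality and simultaneous decompositions *)

Section SingularValueDecomposition.
Context {R : realType} {m n : nat} (lenm : (n <= m)%N).
Local Notation D := (@rdiag R m n).
Local Notation sigma := (@singular_values R m n).

(** The range of [sigma]: the Weyl chamber of signed permutations. *)
Definition chamber : set 'cV[R]_n :=
  [set x | (forall i, 0 <= x i 0) /\ forall i j : 'I_n, (i <= j)%N -> x j 0 <= x i 0].

Lemma chamberD x y : chamber x -> chamber y -> chamber (x + y).
Proof.
move=> [x0 xd] [y0 yd]; split=> [i|i j ij]; rewrite !mxE ?addr_ge0//.
by rewrite lerD ?xd ?yd.
Qed.

Lemma chamber0 : chamber 0.
Proof. by split=> *; rewrite !mxE. Qed.

Lemma singular_values_chamber X : chamber (sigma X).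
Proof. by have [] := singular_valuesP X. Qed.

Lemma singular_values_orthogonal (U : 'M[R]_m) (V : 'M[R]_n) X :
  orthogonal_mx U -> orthogonal_mx V -> sigma (U *m X *m V) = sigma X.
Proof.
move=> UU VV; apply: is_singular_values_unique (singular_valuesP _) _.
have [s0 sd sP] := singular_valuesP X; split=> //; rewrite -sP.
have [VV1 VV2] := (mulmx1_unit VV).
have -> : (U *m X *m V)^T *m (U *m X *m V) = invmx V *m (X^T *m X) *m V.
  have -> : invmx V = V^T by rewrite -[RHS]mulmx1 -(mulmxV VV2) mulmxA VV mul1mx.
  by rewrite !trmx_mul !mulmxA -(mulmxA _ U^T) UU mulmx1.
exact: char_poly_conj.
Qed.

Lemma char_poly_rdiag x :
  char_poly ((D x)^T *m D x) = \prod_(i < n) ('X - (x i 0 ^+ 2)%:P).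
Proof.
have -> : (D x)^T *m D x = diag_mx (\row_i (x i 0 ^+ 2)).
  apply/matrixP => i j; rewrite (tr_rdiag_mulmx lenm) rdiag_embed !mxE.
  by have [->|] := eqVneq i j; rewrite ?mulr1n ?mulr0n ?mulr0// expr2.
rewrite char_poly_trig ?diag_mx_is_trig//.
by apply: eq_bigr => i _; rewrite !mxE eqxx mulr1n.
Qed.

Lemma singular_values_rdiag x : chamber x -> sigma (D x) = x.
Proof.
move=> [x0 xd]; apply: is_singular_values_unique (singular_valuesP _) _.
by split=> //; exact: char_poly_rdiag.
Qed.

(** Any strictly decreasing positive vector would do. *)
Definition weight : 'cV[R]_n := \col_i (n - i)%:R.

Lemma weight_gt0 i : 0 < weight i 0.
Proof. by rewrite mxE ltr0n subn_gt0. Qed.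

Lemma weight_dec (i j : 'I_n) : (i < j)%N -> weight j 0 < weight i 0.
Proof. by move=> ij; rewrite !mxE ltr_nat ltn_sub2l. Qed.

(** The adapted frame for [x = 0], whose stabilizer contains all pairs. *)
Let svd_max (c : 'cV[R]_n) X :
  (forall i, 0 < c i 0) -> (forall i j : 'I_n, (i < j)%N -> c j 0 < c i 0) ->
  exists U V, [/\ orthogonal_mx U, orthogonal_mx V, X = U *m D (sigma X) *m V^T &
    forall U' V', orthogonal_mx U' -> orthogonal_mx V' ->
      inner (D c) (U'^T *m X *m V') <= inner c (sigma X)].
Proof.
move=> c_gt0 c_dec; have z0 i : 0 <= (0 : 'cV[R]_n) i 0 by rewrite mxE.
have [U [V [w [UU VV _ [A [B [_ _ UXV]]] [w_dec w_ge0 wmax]]]]] :=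
  adapted_frame lenm X c_gt0 c_dec z0.
have {}UXV : U^T *m X *m V = D w by rewrite UXV rdiag0 mulmx0 mul0mx subrr addr0.
have wS : sigma X = w.
  rewrite -(singular_values_orthogonal _ (orthogonal_mxT UU) VV) UXV.
  apply: singular_values_rdiag; split=> [i|i j ij]; first by rewrite w_ge0 ?mxE.
  by rewrite w_dec ?mxE.
exists U, V; rewrite wS; split=> //.
  by rewrite -UXV !mulmxA orthogonal_mxV// mul1mx -mulmxA orthogonal_mxV// mulmx1.
by move=> U' V' U'U' V'V'; apply: wmax => //; rewrite rdiag0 mulmx0 mul0mx.
Qed.

Lemma svd X : exists U V, [/\ orthogonal_mx U, orthogonal_mx V &
  X = U *m D (sigma X) *m V^T].
Proof. by have [U [V []]] := svd_max X weight_gt0 weight_dec; exists U, V. Qed.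

(** A maximizer of [<Dc, U^T X V>] diagonalizes [X] when [c] is strictly
    decreasing; general weights follow by perturbation. *)
Lemma inner_frame_le (c : 'cV[R]_n) X U V : chamber c ->
  orthogonal_mx U -> orthogonal_mx V ->
  inner (D c) (U^T *m X *m V) <= inner c (sigma X).
Proof.
move=> [c0 cd] UU VV; rewrite leNgt; apply/negP => lt_c.
have key e : 0 < e -> inner (D c) (U^T *m X *m V) + e * inner (D weight) (U^T *m X *m V)
    <= inner c (sigma X) + e * inner weight (sigma X).
  move=> e0; rewrite -!innerZl -!innerDl -rdiagZ -rdiagD.
  have p0 i : 0 < (c + e *: weight) i 0.
    by have := weight_gt0 i; rewrite !mxE => wi; rewrite ltr_wpDl// mulr_gt0.
  have pd (i j : 'I_n) : (i < j)%N -> (c + e *: weight) j 0 < (c + e *: weight) i 0.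
    move=> ij; have := weight_dec ij; rewrite !mxE => wij.
    by rewrite ler_ltD ?cd ?(ltnW ij)// ltr_pM2l.
  by have [_ [_ [_ _ _]]] := svd_max X p0 pd; apply.
move: key lt_c; set a := inner (D c) _; set b := inner c _.
set p := inner (D weight) _; set q := inner weight _ => key ab.
have d0 : 0 < a - b by rewrite subr_gt0.
have k0 : 0 < `|q - p| + 1 by rewrite ltr_wpDl.
have e0 : 0 < (a - b) / (`|q - p| + 1) by rewrite divr_gt0.
have := key _ e0; set e := (_ / _) in e0 *.
have eE : e * (`|q - p| + 1) = a - b by rewrite divfK// gt_eqF.
have := ler_norm (q - p); nra.
Qed.

(** Put [X] in diagonal form and apply [inner_frame_le] to [Y]. *)
Lemma von_neumann X Y : inner X Y <= inner (sigma X) (sigma Y).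
Proof.
have [U [V [UU VV {1}->]]] := svd X.
rewrite inner_mulr inner_mull trmxK mulmxA; apply: inner_frame_le => //.
exact: singular_values_chamber.
Qed.

Lemma inner_singular_values X : inner (sigma X) (sigma X) = inner X X.
Proof.
have [U [V [UU VV e]]] := svd X; rewrite [in RHS]e inner_orthogonal//.
  by rewrite (inner_rdiag lenm).
exact: orthogonal_mxT.
Qed.

Lemma singular_values_lipschitz X Y : normF (sigma X - sigma Y) <= normF (X - Y).
Proof.
apply: ler_wsqrtr; rewrite !inner_sub_sqr !inner_singular_values.
by rewrite lerD2l lerN2 ler_wpM2l// von_neumann.
Qed.

(** Equality in von Neumann's inequality for all pairs of a finite family means
    a common frame of singular vectors: any frame of the sum [Z] is one.  Indeed
    [sigma Z] is the sum of the [sigma (M a)], hence the pairings of the [M a]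
    with that frame are all extremal. *)
Lemma simultaneous_svd (I : finType) (M : I -> 'M[R]_(m, n)) :
  (forall a b, inner (M a) (M b) = inner (sigma (M a)) (sigma (M b))) ->
  exists U V, [/\ orthogonal_mx U, orthogonal_mx V &
    forall a, M a = U *m D (sigma (M a)) *m V^T].
Proof.
move=> MM; pose Z := \sum_a M a; pose s := \sum_a sigma (M a).
have s_chamber : chamber s.
  rewrite /s; elim/big_rec: _ => [|a x _]; first exact: chamber0.
  exact/chamberD/singular_values_chamber.
have ZZ : inner Z Z = inner s s.
  rewrite /Z /s !inner_suml; apply: eq_bigr => a _.
  by rewrite !inner_sumr; apply: eq_bigr.
have [U [V [UU VV eZ]]] := svd Z.
have frame_le a c : chamber c -> inner (U^T *m M a *m V) (D c) <= inner (sigma (M a)) c.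
  by move=> cc; rewrite innerC [leRHS]innerC; exact: inner_frame_le.
have UZV : U^T *m Z *m V = D (sigma Z).
  rewrite eZ !mulmxA UU mul1mx -mulmxA VV mulmx1.
  by rewrite -eZ.
have sumUV c : \sum_a inner (U^T *m M a *m V) (D c) = inner (sigma Z) c.
  by rewrite -inner_suml -mulmx_suml -mulmx_sumr UZV (inner_rdiag lenm).
have sZ : sigma Z = s.
  (* With [|Z| = |s|] this forces equality in Cauchy-Schwarz. *)
  have le : inner (sigma Z) (sigma Z) <= inner s (sigma Z).
    rewrite -sumUV /s inner_suml; apply: ler_sum => a _.
    exact/frame_le/singular_values_chamber.
  apply/eqP; rewrite -subr_eq0; apply/eqP/inner_eq0/eqP.
  rewrite eq_le inner_ge0 andbT inner_sub_sqr (innerC (sigma Z) s).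
  by move: le; rewrite inner_singular_values ZZ; lra.
have Ms a b : inner (U^T *m M a *m V) (D (sigma (M b))) = inner (sigma (M a)) (sigma (M b)).
  have le k l : inner (U^T *m M k *m V) (D (sigma (M l))) <= inner (sigma (M k)) (sigma (M l)).
    exact/frame_le/singular_values_chamber.
  apply/eqP; rewrite eq_le le/= leNgt; apply/negP => lt_ab.
  have : \sum_k \sum_l inner (U^T *m M k *m V) (D (sigma (M l))) <
         \sum_k \sum_l inner (sigma (M k)) (sigma (M l)).
    rewrite (bigD1 a)//= [ltRHS](bigD1 a)//=; apply: ltr_leD; last first.
      by apply: ler_sum => k _; apply: ler_sum => l _; exact: le.
    rewrite (bigD1 b)//= [ltRHS](bigD1 b)//=; apply: ltr_leD; first exact: lt_ab.
    by apply: ler_sum => l _; exact: le.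
  under eq_bigr do rewrite -inner_sumr -rdiag_sum -/s.
  under [ltRHS]eq_bigr do rewrite -inner_sumr -/s.
  by rewrite sumUV sZ -inner_suml -/s ltxx.
exists U, V; split; [exact: UU|exact: VV|move=> a].
suff <- : U^T *m M a *m V = D (sigma (M a)).
  by rewrite !mulmxA orthogonal_mxV// mul1mx -mulmxA orthogonal_mxV// mulmx1.
apply/eqP; rewrite -subr_eq0; apply/eqP/inner_eq0.
rewrite inner_sub_sqr inner_orthogonal//; last exact: orthogonal_mxT.
by rewrite Ms MM (inner_rdiag lenm); ring.
Qed.

End SingularValueDecomposition.

Section AbsoluteSymmetry.
Context {R : realType} {m n : nat} (lenm : (n <= m)%N).

(** Sorting permutes the factors of the characteristic polynomial of
    [(Dz)^T Dz] and signs disappear in the squares. *)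
Lemma signed_perm_sort (z : 'cV[R]_n) : exists2 Q : 'M[R]_n, signed_perm_mx Q &
  is_singular_values (@rdiag R m n z) (Q *m z).
Proof.
pose t := [tuple `|z i 0| | i < n].
have [s st] : exists s : {perm 'I_n},
    sort >=%R t = [tuple tnth t (s i) | i < n] by apply/tuple_permP; rewrite perm_sort.
have t_dec (i j : 'I_n) : (i <= j)%N -> `|z (s j) 0| <= `|z (s i) 0|.
  have sorted_t : sorted >=%R (sort >=%R t) by apply: sort_sorted => x y; exact: ge_total.
  have nthE (k : 'I_n) : nth 0 (sort >=%R t) k = `|z (s k) 0|.
    by rewrite st -tnth_nth !tnth_mktuple.
  move=> ij; rewrite -!nthE.
  by apply: (sorted_leq_nth ge_trans lexx 0 sorted_t); rewrite ?inE ?size_sort ?size_tuple.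
pose Q : 'M[R]_n := \matrix_(i, j) ((if z j 0 < 0 then -1 else 1) *+ (j == s i)).
have Qz i : (Q *m z) i 0 = `|z (s i) 0|.
  rewrite mxE (bigD1 (s i))//= mxE eqxx mulr1n big1 ?addr0 => [|j ji].
    case: (ltP (z (s i) 0) 0) => zi; first by rewrite mulN1r ltr0_norm.
    by rewrite mul1r ger0_norm.
  by rewrite mxE (negPf ji) mul0r.
have Q_neq0 i j : (Q i j != 0) = (j == s i).
  rewrite mxE; case: (j == s i) => /=; last by rewrite eqxx.
  by case: ifP => _; rewrite mulr1n ?oppr_eq0 oner_neq0.
exists Q; first split=> [i j|i|j].
- rewrite mxE !inE; case: (j == s i) => /=; last by rewrite mulr0n eqxx.
  by case: ifP => _; rewrite mulr1n eqxx ?orbT.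
- by exists (s i); split=> [|j]; rewrite Q_neq0 => // /eqP.
- exists ((s^-1)%g j); split=> [|i]; rewrite Q_neq0 ?permKV//.
  by move/eqP => ->; rewrite permK.
split=> [i|i j ij|]; rewrite ?Qz//; first exact: t_dec.
rewrite char_poly_rdiag// (reindex_inj (@perm_inj _ s)).
by apply: eq_bigr => i _; rewrite Qz real_normK// num_real.
Qed.

(** [f] does not see the signed permutation of [signed_perm_sort]: along a curve [U_t D(z_t) V_t^T] the spectral function is known even
    when [z_t] leaves the chamber. *)
Lemma spectral_rdiag (f : 'cV[R]_n -> \bar R) (U : 'M[R]_m) (V : 'M[R]_n) z :
  absolutely_symmetric f -> orthogonal_mx U -> orthogonal_mx V ->
  f (singular_values (U *m rdiag z *m V)) = f z.
Proof.
move=> fs UU VV; rewrite singular_values_orthogonal//.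
have [Q sQ svQ] := signed_perm_sort z.
by rewrite (is_singular_values_unique (singular_valuesP _) svQ) fs.
Qed.

End AbsoluteSymmetry.

(** * Curves in an orbit and lower limits *)

Section OrbitCurves.
Context {R : realType} {m n : nat} (A : 'M[R]_m) (B : 'M[R]_n).
Hypotheses (skewA : A^T = - A) (skewB : B^T = - B).
Context {T : Type} {F : set_system T} {FF : Filter F} (t : T -> R).
Hypothesis t_right : t x @[x --> F] --> (0 : R)^'+.

Lemma near_right_gt0 : \forall x \near F, 0 < t x.
Proof. exact: (t_right (nbhs_right_gt 0)). Qed.

Lemma cvg_right0 : t x @[x --> F] --> (0 : R).
Proof. by apply: cvg_trans t_right _; exact: cvg_at_right_filter cvg_id. Qed.

(** [C_A = 1 + t P] and [C_B^T = 1 - t Q]. *)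
Let P x := A *m cayley_res A (t x).
Let Q x := - (B *m cayley_res B (t x))^T.

Let cvgP : P x @[x --> F] --> A.
Proof. exact: (cvg_cayley_der skewA cvg_right0). Qed.

Let cvgQ : Q x @[x --> F] --> B.
Proof.
rewrite -[B]opprK -skewB; apply: cvgN; apply: cvg_trmx.
exact: (cvg_cayley_der skewB cvg_right0).
Qed.

Let cayley_mul x (Z : 'M[R]_(m, n)) :
  cayley A (t x) *m Z *m (cayley B (t x))^T =
  Z + t x *: (P x *m Z - Z *m Q x - t x *: (P x *m Z *m Q x)).
Proof.
have -> : (cayley B (t x))^T = 1%:M - t x *: Q x.
  by rewrite cayleyE// linearD/= linearZ/= trmx1 /Q scalerN opprK.
rewrite cayleyE// -/(P x) mulmxDl mul1mx mulmxBr !mulmx1 mulmxDl.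
rewrite -!scalemxAl -!scalemxAr !scalerBr !scalerA.
by apply/matrixP => i j; rewrite !mxE; ring.
Qed.

Lemma cvg_orbit_quotient (Z : T -> 'M[R]_(m, n)) (Z0 Z1 : 'M[R]_(m, n)) :
  Z x @[x --> F] --> Z0 -> (t x)^-1 *: (Z x - Z0) @[x --> F] --> Z1 ->
  (t x)^-1 *: (cayley A (t x) *m Z x *m (cayley B (t x))^T - Z0) @[x --> F]
    --> Z1 + (A *m Z0 - Z0 *m B).
Proof.
move=> cZ cZ1.
have lim : (t x)^-1 *: (Z x - Z0) +
    (P x *m Z x - Z x *m Q x - t x *: (P x *m Z x *m Q x)) @[x --> F]
    --> Z1 + (A *m Z0 - Z0 *m B - 0 *: (A *m Z0 *m B)).
  apply: cvg_mx_add => //; apply: cvg_mx_sub; first by apply: cvg_mx_sub; exact: cvg_mulmx.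
  by apply: cvgZ; [exact: cvg_right0|do 2?apply: cvg_mulmx].
rewrite scale0r subr0 in lim; apply: cvg_trans lim; apply: near_eq_cvg.
near=> x; have tx : t x != 0 by rewrite gt_eqF//; near: x; exact: near_right_gt0.
rewrite cayley_mul; move: (P x *m Z x - _ - _) => S.
by apply/matrixP => i j; rewrite !mxE; field.
Unshelve. all: by end_near. Qed.

(** Twice the [t^2] coefficient of [<Dy, C_A(t) Z C_B(t)^T>]. *)
Definition curvature (y : 'cV[R]_n) (Z : 'M[R]_(m, n)) :=
  inner (rdiag y) (A *m (A *m Z) + Z *m B *m B - 2 *: (A *m Z *m B)).

(** The remainder is explicit: [P = A + (t/2) A P] and [Q = B - (t/2) Q B]. *)
Lemma cvg_orbit_curvature y (Z : T -> 'M[R]_(m, n)) (Z0 : 'M[R]_(m, n)) :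
  Z x @[x --> F] --> Z0 ->
  (2^-1 * t x ^+ 2)^-1 *
    (inner (rdiag y) (cayley A (t x) *m Z x *m (cayley B (t x))^T - Z x) -
     t x * inner (rdiag y) (A *m Z x - Z x *m B)) @[x --> F]
  --> curvature y Z0.
Proof.
move=> cZ.
have lim : inner (rdiag y) (A *m (P x *m Z x) + Z x *m Q x *m B -
    2 *: (P x *m Z x *m Q x)) @[x --> F] --> curvature y Z0.
  apply: cvg_inner; first exact: cvg_cst.
  apply: cvg_mx_sub; last first.
    by apply: cvgZ; [exact: cvg_cst|do 2?apply: cvg_mulmx].
  apply: cvg_mx_add; apply: cvg_mulmx; try exact: cvg_cst; exact: cvg_mulmx.
apply: cvg_trans lim; apply: near_eq_cvg; near=> x.
have tx : t x != 0 by rewrite gt_eqF//; near: x; exact: near_right_gt0.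
have PE : P x = A + (t x / 2) *: (A *m P x).
  by rewrite {1}/P {1}cayley_resE// mulmxDr mulmx1 -scalemxAr.
have QE : Q x = B - (t x / 2) *: (Q x *m B).
  rewrite {1}/Q {1}cayley_resE// mulmxDr mulmx1 -scalemxAr linearD/= linearZ/=.
  rewrite [in X in _ *: X]trmx_mul skewB opprD opprK; congr (_ + _).
  by rewrite mulmxN scalerN opprK /Q mulNmx scalerN opprK.
rewrite cayley_mul [Z x + _]addrC addrK.
have PZ : P x *m Z x = A *m Z x + (t x / 2) *: (A *m (P x *m Z x)).
  by rewrite {1}PE mulmxDl -scalemxAl mulmxA.
have ZQ : Z x *m Q x = Z x *m B - (t x / 2) *: (Z x *m Q x *m B).
  by rewrite {1}QE mulmxBr -scalemxAr mulmxA.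
rewrite innerZr -mulrBr -innerBr.
have -> : P x *m Z x - Z x *m Q x - t x *: (P x *m Z x *m Q x) -
    (A *m Z x - Z x *m B) = (t x / 2) *:
    (A *m (P x *m Z x) + Z x *m Q x *m B - 2 *: (P x *m Z x *m Q x)).
  rewrite {1}PZ {1}ZQ; move: (A *m Z x) (Z x *m B) => a b.
  move: (A *m (P x *m Z x)) (Z x *m Q x *m B) (P x *m Z x *m Q x) => c d e.
  by apply/matrixP => i j; rewrite !mxE; field.
by rewrite innerZr; field.
Unshelve. all: by end_near. Qed.

End OrbitCurves.

Section Liminf.
Context {R : realType} {p q : nat}.
Local Notation E := 'M[R]_(p, q).
Implicit Types (D : R -> E -> \bar R) (w : E).
Local Open Scope ereal_scope.

Lemma liminf_right_gt D w (l : \bar R) : l < liminf_right D w ->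
  \forall tw \near filter_prod (0%R : R)^'+ (nbhs w), l < D tw.1 tw.2.
Proof.
rewrite /liminf_right limf_einfE => /ereal_sup_gt[_ [V FV <-] lV].
apply: filterS FV => tw Vtw; apply: lt_le_trans lV _.
by apply: ereal_inf_lbound; exists tw.
Qed.

Lemma liminf_right_ge D w (l : \bar R) :
  (\forall tw \near filter_prod (0%R : R)^'+ (nbhs w), l <= D tw.1 tw.2) ->
  l <= liminf_right D w.
Proof.
move=> lD; rewrite /liminf_right limf_einfE; apply: ereal_sup_ge.
exists (ereal_inf ((fun tw : R * E => D tw.1 tw.2) @` [set tw | l <= D tw.1 tw.2])).
  by exists [set tw | l <= D tw.1 tw.2].
by apply: le_ereal_inf_tmp => _ [tw /= ltw <-].
Qed.

Lemma cvg_right_seq (t : nat -> R) : (forall k, 0 < t k)%R ->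
  t @ \oo --> (0 : R)%R -> t @ \oo --> (0%R : R)^'+.
Proof.
by move=> t_gt0 t0 P /t0; apply: (@filterS _ \oo) => k Pk; exact: (Pk (t_gt0 k)).
Qed.

(** A first-order gap [h] enters second-order quotients divided by [t / 2]. *)
Lemma liminf_right_pinfty D w (h : R * E -> R) (d : R) : (0 < d)%R ->
  h tw @[tw --> filter_prod (0%R : R)^'+ (nbhs w)] --> d ->
  (\forall tw \near filter_prod (0%R : R)^'+ (nbhs w),
     (h tw * (2^-1 * tw.1)^-1)%:E <= D tw.1 tw.2) ->
  liminf_right D w = +oo.
Proof.
move=> d0 hd hD; apply/eqyP => M M0; apply: liminf_right_ge.
have fst_right : tw.1 @[tw --> filter_prod (0%R : R)^'+ (nbhs w)] --> (0%R : R)^'+.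
  exact: cvg_fst.
near=> tw; apply: (@le_trans _ _ (h tw * (2^-1 * tw.1)^-1)%:E); last by near: tw.
have t_gt0 : (0 < tw.1)%R by near: tw; exact: near_right_gt0 fst_right.
rewrite lee_fin ler_pdivlMr ?mulr_gt0//.
have hd2 : (d / 2 <= h tw)%R by near: tw; apply: (cvgr_ge d hd); lra.
apply: le_trans hd2.
have tM : (tw.1 <= d / M)%R.
  by near: tw; apply: (cvgr_le 0%R (cvg_right0 fst_right)); rewrite divr_gt0.
by move: tM; rewrite ler_pdivlMr//; lra.
Unshelve. all: by end_near. Qed.

Lemma recovery_pinfty D w : liminf_right D w = +oo -> recovery D w (liminf_right D w).
Proof.
move=> Doo t t_gt0 t0; exists (fun=> w); first exact: cvg_cst.
rewrite Doo; apply/cvgeyPgt => M.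
have /liminf_right_gt near_M : M%:E < liminf_right D w by rewrite Doo ltry.
exact: (cvg_pair (cvg_right_seq t_gt0 t0) (cvg_cst w)) near_M.
Qed.

(** A recovery sequence is extracted diagonally: [u k] nearly minimizes the
    larger of [|u - w|] and the excess of [D (t k) u] over the limit. *)
Lemma recovery_of_approx D w (l : R) : liminf_right D w = l%:E ->
  (forall t : nat -> R, (forall k, 0 < t k)%R -> t @ \oo --> (0 : R)%R ->
   forall e, (0 < e)%R -> \forall k \near \oo,
     exists2 u, (normF (u - w) <= e)%R & D (t k) u <= (l + e)%:E) ->
  recovery D w (liminf_right D w).
Proof.
move=> Dl approx t t_gt0 t0; have {}approx := approx t t_gt0 t0.
pose S k := [set r : R | (0 <= r)%R /\
  exists2 u, (normF (u - w) <= r)%R & D (t k) u <= (l + r)%:E].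
have S_lb k : has_lbound (S k) by exists 0%R => r [].
have [u uP] : {u : nat -> E & forall k, S k !=set0 ->
    exists r, [/\ (r < inf (S k) + k.+1%:R^-1)%R, (normF (u k - w) <= r)%R &
                  D (t k) (u k) <= (l + r)%:E]}.
  apply: (@choice nat E (fun k v => S k !=set0 ->
    exists r, [/\ (r < inf (S k) + k.+1%:R^-1)%R, (normF (v - w) <= r)%R &
                  D (t k) v <= (l + r)%:E])) => k.
  have [S0|noS] := pselect (S k !=set0); last by exists w.
  have k0 : (0 < k.+1%:R^-1 :> R)%R by rewrite invr_gt0.
  have [r [r0 [v vr Dr]] rk] := inf_adherent k0 (conj S0 (S_lb k)).
  by exists v => _; exists r.
have near_u e : (0 < e)%R -> \forall k \near \oo,
    (normF (u k - w) <= e)%R /\ D (t k) (u k) <= (l + e)%:E.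
  move=> e0; have e2 : (0 < e / 2)%R by rewrite divr_gt0.
  near=> k; have Sk : S k (e / 2)%R.
    by split; [exact: ltW|near: k; exact: approx].
  have [r [rk ur Dr]] := uP k (ex_intro _ _ Sk).
  have k_small : (k.+1%:R^-1 <= e / 2)%R.
    by apply: ltW; near: k; exact: near_infty_natSinv_lt (PosNum e2).
  have re : (r <= e)%R.
    apply/ltW/(lt_le_trans rk); rewrite [leRHS]splitr lerD//.
    exact: ge_inf (S_lb k) _ Sk.
  split; first exact: le_trans re.
  by apply: le_trans Dr _; rewrite lee_fin lerD2l.
have t_right := cvg_right_seq t_gt0 t0.
have u_w : u k @[k --> \oo] --> w.
  apply/(@cvg_normF0 R _ \oo); apply/cvgrPdist_le => e e0.
  apply: (@filterS _ \oo) (near_u e e0) => k [uk _].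
  by rewrite sub0r normrN ger0_norm ?normF_ge0.
exists u; first exact: u_w.
have near_l e : (0 < e)%R -> \forall k \near \oo, (l - e)%:E < D (t k) (u k) <= (l + e)%:E.
  move=> e0; have /liminf_right_gt lt_l : (l - e)%:E < liminf_right D w.
    by rewrite Dl lte_fin; lra.
  have gt_l : \forall k \near \oo, (l - e)%:E < D (t k) (u k).
    exact: (cvg_pair t_right u_w) lt_l.
  near=> k; apply/andP; split; first by near: k.
  by have [] : (normF (u k - w) <= e)%R /\ D (t k) (u k) <= (l + e)%:E
    by near: k; exact: near_u.
rewrite Dl; apply/fine_cvgP; split.
  apply: filterS (near_l 1%R ltr01) => k /andP[lk kl].
  by rewrite fin_numE gt_eqF ?(lt_trans (ltNyr _) lk)// lt_eqF// (le_lt_trans kl) ?ltry.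
apply/cvgrPdist_le => e e0; apply: filterS (near_l e e0) => k /=.
case: (D (t k) (u k)) => [r| |] /andP[] //=.
by rewrite lte_fin lee_fin ler_norml => *; apply/andP; split; lra.
Unshelve. all: by end_near. Qed.

End Liminf.

(** * Directional derivatives of singular values *)

Section DirectionalDerivative.
Context {R : realType} {m n : nat} (lenm : (n <= m)%N).
Local Notation D := (@rdiag R m n).
Local Notation sigma := (@singular_values R m n).

(** The ray can leave the chamber at once only through a wall containing [x];
    on those walls [w] points inwards. *)
Lemma chamber_ray (x w : 'cV[R]_n) : chamber x ->
  (forall i j : 'I_n, (i <= j)%N -> x i 0 = x j 0 -> w j 0 <= w i 0) ->
  (forall i, x i 0 = 0 -> 0 <= w i 0) ->
  \forall t \near (0 : R)^'+, chamber (x + t *: w).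
Proof.
move=> [x0 xd] wd w0.
have near_ge0 (a b : R) : 0 <= a -> (a = 0 -> 0 <= b) ->
    \forall t \near (0 : R)^'+, 0 <= a + t * b.
  rewrite le_eqVlt => /orP[/eqP <- /(_ erefl) b0|a0 _].
    near=> t; rewrite add0r mulr_ge0//; apply: ltW; near: t; exact: nbhs_right_gt.
  have lim : a + t * b @[t --> (0 : R)^'+] --> a + 0 * b.
    apply: cvgD; first exact: cvg_cst.
    by apply: cvgMl; exact: cvg_at_right_filter cvg_id.
  by rewrite mul0r addr0 in lim; exact: cvgr_ge lim _ a0.
have near0 : \forall t \near (0 : R)^'+, forall i, 0 <= x i 0 + t * w i 0.
  by apply: filter_forall => i; apply: near_ge0 => //; exact: w0.
have neard : \forall t \near (0 : R)^'+, forall ij : 'I_n * 'I_n, (ij.1 <= ij.2)%N ->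
    0 <= (x ij.1 0 - x ij.2 0) + t * (w ij.1 0 - w ij.2 0).
  apply: filter_forall => -[i j] /=; have [ij|ij] := leqP i j; last first.
    by apply: filterE => t.
  have := near_ge0 (x i 0 - x j 0) (w i 0 - w j 0).
  rewrite !subr_ge0 => /(_ (xd _ _ ij))[|].
    by move=> /eqP; rewrite subr_eq0 => /eqP; exact: wd.
  move=> e e0 h; exists e => // t te t0 _; exact: h.
near=> t; split=> [i|i j ij]; rewrite !mxE.
  by move: i; near: t.
rewrite -subr_ge0.
have -> : x i 0 + t * w i 0 - (x j 0 + t * w j 0) =
  (x i 0 - x j 0) + t * (w i 0 - w j 0) by ring.
have : forall ij : 'I_n * 'I_n, (ij.1 <= ij.2)%N ->
    0 <= (x ij.1 0 - x ij.2 0) + t * (w ij.1 0 - w ij.2 0) by near: t.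
by move=> /(_ (i, j)); apply.
Unshelve. all: by end_near. Qed.

(** The adapted frame of [W] relative to a singular value decomposition of [X]. *)
Lemma directional_frame (X W : 'M[R]_(m, n)) : exists U V w A B,
  [/\ orthogonal_mx U, orthogonal_mx V, A^T = - A & B^T = - B] /\
  [/\ X = U *m D (sigma X) *m V^T,
      W = U *m (D w + (A *m D (sigma X) - D (sigma X) *m B)) *m V^T &
      \forall t \near (0 : R)^'+, chamber (sigma X + t *: w)].
Proof.
have [x0 xd] := singular_values_chamber X; set x := sigma X in x0 xd *.
have [U1 [V1 [UU1 VV1 eX]]] := svd lenm X.
have [U2 [V2 [w [UU2 VV2 UV2 [A [B [skA skB eW]]] [wd w0 _]]]]] :=
  adapted_frame lenm (U1^T *m W *m V1) (@weight_gt0 R n) (@weight_dec R n) x0.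
exists (U1 *m U2), (V1 *m V2), w, A, B; split.
  by split; [exact: orthogonal_mxM UU1 UU2|exact: orthogonal_mxM VV1 VV2|exact: skA|exact: skB].
split; last exact: chamber_ray (conj x0 xd) wd w0.
  rewrite trmx_mul !mulmxA -(mulmxA U1) UV2 -!mulmxA (mulmxA V2).
  by rewrite (orthogonal_mxV VV2) mul1mx mulmxA -eX.
rewrite -eW trmx_mul !mulmxA -(mulmxA U1 U2) (orthogonal_mxV UU2) mulmx1.
rewrite (orthogonal_mxV UU1) mul1mx -!mulmxA (mulmxA V2) (orthogonal_mxV VV2).
by rewrite mul1mx (orthogonal_mxV VV1) mulmx1.
Qed.

Section Limits.
Context {T : Type} {F : set_system T} {FF : Filter F} (t : T -> R).
Hypothesis t_right : t x @[x --> F] --> (0 : R)^'+.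

Lemma cvg_rdiag (u : T -> 'cV[R]_n) (u0 : 'cV[R]_n) :
  u k @[k --> F] --> u0 -> D (u k) @[k --> F] --> D u0.
Proof.
move=> uu0; apply/cvg_mxP => i j; rewrite mxE; under eq_cvg do rewrite mxE.
case: (i == j :> nat); rewrite ?mulr1n ?mulr0n; last exact: cvg_cst.
by have /cvg_mxP := uu0; apply.
Qed.

(** The two sources of velocity: the diagonal moves along [w], the frame turns
    along [(A, B)]. *)
Lemma cvg_frame_curve (U : 'M[R]_m) (V : 'M[R]_n) (A : 'M[R]_m) (B : 'M[R]_n)
    (x w : 'cV[R]_n) (z : T -> 'cV[R]_n) :
  A^T = - A -> B^T = - B -> z k @[k --> F] --> w ->
  (t k)^-1 *: (U *m (cayley A (t k) *m D (x + t k *: z k) *m (cayley B (t k))^T) *m V^T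
     - U *m D x *m V^T) @[k --> F]
  --> U *m (D w + (A *m D x - D x *m B)) *m V^T.
Proof.
move=> skA skB zw; have t0 := cvg_right0 t_right.
have cZ : D (x + t k *: z k) @[k --> F] --> D x.
  apply: cvg_rdiag; have := cvg_mx_add (cvg_cst x) (cvgZ t0 zw).
  by rewrite scale0r addr0; exact.
have cZ1 : (t k)^-1 *: (D (x + t k *: z k) - D x) @[k --> F] --> D w.
  apply: cvg_trans (cvg_rdiag zw); apply: near_eq_cvg; near=> k.
  have tk : t k != 0 by rewrite gt_eqF//; near: k; exact: near_right_gt0.
  by rewrite rdiagD addrC addKr rdiagZ scalerA mulVf// scale1r.
have lim := cvg_mulmx (cvg_mulmx (cvg_cst U)
  (cvg_orbit_quotient skA skB t_right cZ cZ1)) (cvg_cst V^T).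
have conjE k (M N : 'M[R]_(m, n)) :
    (t k)^-1 *: (U *m M *m V^T - U *m N *m V^T) = U *m ((t k)^-1 *: (M - N)) *m V^T.
  by rewrite -scalemxAr -scalemxAl mulmxBr mulmxBl.
under eq_cvg do rewrite conjE.
exact: lim.
Unshelve. all: by end_near. Qed.

(** Directional differentiability in the sense of Hadamard.  Along the curve
    [U C_A(t) D(x + t w) C_B(t)^T V^T] the singular values are exactly [x + t w];
    this curve has velocity [W], and [sigma] is 1-Lipschitz. *)
Lemma cvg_singular_values_quotient (U : 'M[R]_m) (V : 'M[R]_n) (A : 'M[R]_m)
    (B : 'M[R]_n) (w : 'cV[R]_n) (X W : 'M[R]_(m, n)) (W' : T -> 'M[R]_(m, n)) :
  orthogonal_mx U -> orthogonal_mx V -> A^T = - A -> B^T = - B ->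
  X = U *m D (sigma X) *m V^T ->
  W = U *m (D w + (A *m D (sigma X) - D (sigma X) *m B)) *m V^T ->
  (\forall t \near (0 : R)^'+, chamber (sigma X + t *: w)) ->
  W' k @[k --> F] --> W ->
  (t k)^-1 *: (sigma (X + t k *: W' k) - sigma X) @[k --> F] --> w.
Proof.
move=> UU VV skA skB eX eW near_chamber cW'.
set x := sigma X in eX eW near_chamber *.
pose G k := U *m (cayley A (t k) *m D (x + t k *: w) *m (cayley B (t k))^T) *m V^T.
have cG : (t k)^-1 *: (G k - X) @[k --> F] --> W.
  rewrite {1}eX eW; exact: cvg_frame_curve skA skB (cvg_cst w).
have /cvg_normF0 cdiff : W' k - (t k)^-1 *: (G k - X) @[k --> F] --> W - W.
  exact: cvg_mx_sub.
apply/cvg_normF0; apply: squeeze_cvgr (cvg_cst 0) cdiff; near=> k.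
rewrite normF_ge0/=.
have tk : 0 < t k by near: k; exact: near_right_gt0.
have sG : sigma (G k) = x + t k *: w.
  have -> : G k = U *m cayley A (t k) *m D (x + t k *: w) *m (V *m cayley B (t k))^T.
    by rewrite /G trmx_mul !mulmxA.
  rewrite singular_values_orthogonal.
  - by apply: (singular_values_rdiag lenm); near: k; exact: (t_right near_chamber).
  - exact: orthogonal_mxM UU (cayley_orthogonal skA _).
  - exact: orthogonal_mxT (orthogonal_mxM VV (cayley_orthogonal skB _)).
have normFZ p q (M : 'M[R]_(p, q)) : normF ((t k)^-1 *: M) = (t k)^-1 * normF M.
  rewrite /normF innerZl innerZr mulrA -expr2 sqrtrM ?sqr_ge0// sqrtr_sqr.
  by rewrite ger0_norm// invr_ge0 ltW.
have -> : (t k)^-1 *: (sigma (X + t k *: W' k) - x) - w =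
    (t k)^-1 *: (sigma (X + t k *: W' k) - sigma (G k)).
  rewrite sG; apply/matrixP => i j; rewrite !mxE; field; exact: lt0r_neq0.
have -> : W' k - (t k)^-1 *: (G k - X) - (W - W) = (t k)^-1 *: (X + t k *: W' k - G k).
  rewrite subrr subr0; apply/matrixP => i j; rewrite !mxE.
  by field; exact: lt0r_neq0.
by rewrite !normFZ ler_wpM2l ?invr_ge0 ?(ltW tk)// (singular_values_lipschitz lenm).
Unshelve. all: by end_near. Qed.

End Limits.

End DirectionalDerivative.

(** * Second-order behaviour of the trace gap *)

Section CriticalFrame.
Context {R : realType} {m n : nat} (lenm : (n <= m)%N).
Local Notation D := (@rdiag R m n).
Local Notation sigma := (@singular_values R m n).

(** Equality in von Neumann's inequality makes [(1, 1)] a maximizer of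
    [<U^T Y V, X>]; stationarity is orthogonality of [Y] to the orbit of [X]. *)
Lemma trace_equality_tangent (X Y : 'M[R]_(m, n)) (U : 'M[R]_m) (V : 'M[R]_n)
    (A : 'M[R]_m) (B : 'M[R]_n) :
  inner X Y = inner (sigma X) (sigma Y) ->
  orthogonal_mx U -> orthogonal_mx V -> X = U *m D (sigma X) *m V^T ->
  A^T = - A -> B^T = - B ->
  inner (U *m (A *m D (sigma X) - D (sigma X) *m B) *m V^T) Y = 0.
Proof.
move=> XY UU VV eX skA skB; pose Y' := U^T *m Y *m V.
have DY' : inner (D (sigma X)) Y' = inner (sigma X) (sigma Y).
  by rewrite -XY [in RHS]eX inner_mulr inner_mull trmxK mulmxA.
have max1 U' V' : orthogonal_mx U' -> orthogonal_mx V' ->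
    U' *m (0 : 'M[R]_(m, n)) = 0 *m V' ->
    inner (D (sigma X)) (U'^T *m Y' *m V') <= inner (D (sigma X)) Y'.
  move=> U'U' V'V' _; rewrite DY'.
  have <- : sigma Y' = sigma Y.
    by apply: singular_values_orthogonal => //; exact: orthogonal_mxT.
  by apply: (inner_frame_le lenm) => //; exact: singular_values_chamber.
have AB0 : A *m (0 : 'M[R]_(m, n)) = 0 *m B by rewrite mulmx0 mul0mx.
have e := stabilizer_stationary max1 skA skB AB0.
rewrite inner_mulr inner_mull trmxK mulmxA -/Y' innerBl inner_mull inner_mulr.
by rewrite skA skB mulNmx mulmxN !innerNr e subrr.
Qed.

(** By [trace_equality_tangent] the tangent part of [W] is orthogonal to [Y], so
    that criticality reads [<U Dw V^T, Y> = <w, y>].  Hence [X], [Y] and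
    [X1 = U D(x + s w) V^T] attain equality pairwise in von Neumann's inequality;
    a common frame of the three also diagonalizes [U Dw V^T]. *)
Lemma critical_frame (X Y W : 'M[R]_(m, n)) (U : 'M[R]_m) (V : 'M[R]_n)
    (w : 'cV[R]_n) (A : 'M[R]_m) (B : 'M[R]_n) :
  inner X Y = inner (sigma X) (sigma Y) -> inner Y W = inner (sigma Y) w ->
  orthogonal_mx U -> orthogonal_mx V -> A^T = - A -> B^T = - B ->
  X = U *m D (sigma X) *m V^T ->
  W = U *m (D w + (A *m D (sigma X) - D (sigma X) *m B)) *m V^T ->
  (\forall t \near (0 : R)^'+, chamber (sigma X + t *: w)) ->
  exists U' V' A' B',
    [/\ orthogonal_mx U', orthogonal_mx V', A'^T = - A' & B'^T = - B'] /\
    [/\ X = U' *m D (sigma X) *m V'^T, Y = U' *m D (sigma Y) *m V'^T &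
        W = U' *m (D w + (A' *m D (sigma X) - D (sigma X) *m B')) *m V'^T].
Proof.
move=> XY YW UU VV skA skB eX eW near_chamber.
have [s [s_chamber s0]] : exists s, chamber (sigma X + s *: w) /\ 0 < s.
  apply: (@filter_ex _ (0 : R)^'+); near=> t.
  by split; near: t; [exact: near_chamber|exact: nbhs_right_gt].
pose X1 := U *m D (sigma X + s *: w) *m V^T.
have VT := orthogonal_mxT VV.
have sX1 : sigma X1 = sigma X + s *: w.
  by rewrite /X1 singular_values_orthogonal// (singular_values_rdiag lenm).
have X1E : X1 = X + s *: (U *m D w *m V^T).
  by rewrite /X1 rdiagD rdiagZ mulmxDr mulmxDl -eX -scalemxAr -scalemxAl.
have wY : inner (U *m D w *m V^T) Y = inner w (sigma Y).
  rewrite [RHS]innerC -YW innerC eW mulmxDr mulmxDl innerDr.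
  by rewrite [X in _ + X]innerC trace_equality_tangent// addr0.
have Xw : inner X (U *m D w *m V^T) = inner (sigma X) w.
  rewrite {1}eX inner_orthogonal; [exact: inner_rdiag|exact: UU|exact: VT].
have X1Y : inner X1 Y = inner (sigma X1) (sigma Y).
  by rewrite sX1 X1E !innerDl !innerZl wY XY.
have XX1 : inner X X1 = inner (sigma X) (sigma X1).
  by rewrite sX1 X1E !innerDr !innerZr Xw (inner_singular_values lenm).
clearbody X1; pose M (a : option bool) := if a is Some b then if b then X1 else Y else X.
have [U' [V' [UU' VV' eM]]] : exists U V, [/\ orthogonal_mx U, orthogonal_mx V &
    forall a, M a = U *m D (sigma (M a)) *m V^T].
  apply: (simultaneous_svd lenm).
  have norm_eq Z := esym (inner_singular_values lenm Z).
  have symE Z Z' : inner Z Z' = inner (sigma Z) (sigma Z') ->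
    inner Z' Z = inner (sigma Z') (sigma Z) by move=> e; rewrite (innerC Z') (innerC (sigma Z')); exact: e.
  move=> [[]|] [[]|]; rewrite /M.
  - exact: norm_eq.
  - exact: X1Y.
  - exact: symE XX1.
  - exact: symE X1Y.
  - exact: norm_eq.
  - exact: symE XY.
  - exact: XX1.
  - exact: XY.
  - exact: norm_eq.
have eX' : X = U' *m D (sigma X) *m V'^T := eM None.
have eX1' : X1 = U' *m D (sigma X1) *m V'^T := eM (Some true).
have eY' : Y = U' *m D (sigma Y) *m V'^T := eM (Some false).
have ew : U *m D w *m V^T = U' *m D w *m V'^T.
  have : s *: (U *m D w *m V^T) = s *: (U' *m D w *m V'^T).
    apply: (addrI X); rewrite -X1E eX1' sX1 rdiagD rdiagZ mulmxDr mulmxDl -eX'.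
    by rewrite -scalemxAr -scalemxAl.
  by move/(congr1 (fun N => s^-1 *: N)); rewrite !scalerA mulVf ?gt_eqF// !scale1r.
exists U', V', (U'^T *m U *m A *m U^T *m U'), (V'^T *m V *m B *m V^T *m V').
split; first split=> //.
- by rewrite !trmx_mul !trmxK skA !mulmxA mulmxN !mulNmx.
- by rewrite !trmx_mul !trmxK skB !mulmxA mulmxN !mulNmx.
split; [exact: eX'|exact: eY'|].
rewrite eW !(mulmxDr _ (D w)) !mulmxDl ew; congr (_ + _).
rewrite !mulmxBr !mulmxBl; congr (_ - _).
- rewrite !mulmxA (orthogonal_mxV UU') mul1mx -(mulmxA _ U' (D _)).
  rewrite -(mulmxA _ (U' *m _)) -eX' {2}eX !mulmxA.
  by rewrite -(mulmxA _ U^T U) UU mulmx1.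
- rewrite !mulmxA -eX' -(mulmxA _ V' V'^T) (orthogonal_mxV VV') mulmx1.
  by rewrite {2}eX -(mulmxA _ V^T V) VV mulmx1.
Unshelve. all: by end_near. Qed.

End CriticalFrame.

Section CurvatureBound.
Context {R : realType} {m n : nat} (lenm : (n <= m)%N).
Local Notation D := (@rdiag R m n).
Local Notation sigma := (@singular_values R m n).
Context (X Y W : 'M[R]_(m, n)) (U : 'M[R]_m) (V : 'M[R]_n) (w : 'cV[R]_n).
Context (A : 'M[R]_m) (B : 'M[R]_n).
Local Notation x := (sigma X).
Local Notation y := (sigma Y).
Hypotheses (UU : orthogonal_mx U) (VV : orthogonal_mx V).
Hypotheses (skewA : A^T = - A) (skewB : B^T = - B).
Hypothesis eX : X = U *m D (sigma X) *m V^T.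
Hypothesis eY : Y = U *m D (sigma Y) *m V^T.
Hypothesis eW : W = U *m (D w + (A *m D (sigma X) - D (sigma X) *m B)) *m V^T.

Let innerY M : inner Y M = inner (D (sigma Y)) (U^T *m M *m V).
Proof. by rewrite {1}eY inner_mulr inner_mull trmxK mulmxA. Qed.

Context {T : Type} {F : set_system T} {FF : Filter F} (t : T -> R).
Hypothesis t_right : t k @[k --> F] --> (0 : R)^'+.

(** Lower estimate for the second-order part of the trace gap: test von
    Neumann's inequality on [Y] transported along the same curve [(A, B)]. *)
Lemma trace_gap_lower_bound (W' : T -> 'M[R]_(m, n)) (e : R) :
  W' k @[k --> F] --> W -> 0 < e ->
  \forall k \near F, - curvature A B (sigma Y) (D (sigma X)) - e <=
    (inner (sigma Y) (sigma (X + t k *: W' k)) - inner Y (X + t k *: W' k)) *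
    (2^-1 * t k ^+ 2)^-1.
Proof.
move=> cW' e0.
have skewN r (S : 'M[R]_r) : S^T = - S -> (- S)^T = - - S.
  by move=> skS; rewrite linearN/= skS.
have nskA := skewN _ _ skewA; have nskB := skewN _ _ skewB.
pose H k := U^T *m W' k *m V.
have cH : H k @[k --> F] --> D w + (A *m D x - D x *m B).
  have -> : D w + (A *m D x - D x *m B) = U^T *m W *m V.
    by rewrite eW !mulmxA UU mul1mx -mulmxA VV mulmx1.
  by apply: cvg_mulmx; [apply: cvg_mulmx => //|]; exact: cvg_cst.
pose Z k := U^T *m (X + t k *: W' k) *m V.
have ZE k : Z k = D x + t k *: H k.
  rewrite /Z mulmxDr mulmxDl -scalemxAr -scalemxAl {1}eX !mulmxA UU mul1mx.
  by rewrite -mulmxA VV mulmx1.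
have cZ : Z k @[k --> F] --> D x.
  under eq_cvg do rewrite ZE.
  have := cvg_mx_add (cvg_cst (D x)) (cvgZ (cvg_right0 t_right) cH).
  by rewrite scale0r addr0; exact.
(* The first-order term vanishes at [Dx], which promotes the velocity of [Z] to
   second order. *)
pose lin k := inner (D y) (- A *m H k - H k *m - B).
have clin : lin k @[k --> F] --> - curvature A B y (D x).
  have -> : - curvature A B y (D x) = inner (D y)
      (- A *m (D w + (A *m D x - D x *m B)) - (D w + (A *m D x - D x *m B)) *m - B).
    rewrite mulNmx mulmxN opprK addrC -opprB innerNr; congr (- _).
    rewrite mulmxDr mulmxDl opprD addrACA innerDr (inner_rdiag_tangent lenm)// add0r.
    rewrite /curvature; congr (inner _ _); rewrite mulmxBr mulmxBl !mulmxA.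
    move: (A *m A *m D x) (A *m D x *m B) (D x *m B *m B) => a b c.
    by apply/matrixP => i j; rewrite !mxE; ring.
  apply: cvg_inner; first exact: cvg_cst.
  by apply: cvg_mx_sub; apply: cvg_mulmx => //; exact: cvg_cst.
have ccurv := @cvg_orbit_curvature _ _ _ _ _ nskA nskB _ _ FF _ t_right y _ _ cZ.
have curvN : curvature (- A) (- B) y (D x) = curvature A B y (D x).
  by rewrite /curvature !mulNmx !mulmxN !mulNmx !opprK.
have lim : (2^-1 * t k ^+ 2)^-1 *
    (inner (D y) (cayley (- A) (t k) *m Z k *m (cayley (- B) (t k))^T - Z k) -
     t k * inner (D y) (- A *m Z k - Z k *m - B)) + 2 * lin k @[k --> F]
    --> - curvature A B y (D x).
  have -> : - curvature A B y (D x) =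
      curvature (- A) (- B) y (D x) + 2 * - curvature A B y (D x).
    by rewrite curvN; ring.
  by apply: cvgD; [exact: ccurv|apply: cvgM; [exact: cvg_cst|exact: clin]].
have lt_e : - curvature A B y (D x) - e < - curvature A B y (D x).
  by rewrite ltrBlDr ltrDl.
have := @cvgr_ge _ _ _ FF _ _ lim _ lt_e.
apply: filterS2 (near_right_gt0 t_right) => k tk /le_trans; apply.
have k0 : 0 < (2^-1 * t k ^+ 2)^-1 by rewrite invr_gt0 mulr_gt0// exprn_gt0.
have frame : inner (D y) (cayley (- A) (t k) *m Z k *m (cayley (- B) (t k))^T) <=
    inner y (sigma (X + t k *: W' k)).
  have -> : cayley (- A) (t k) *m Z k *m (cayley (- B) (t k))^T =
      (U *m (cayley (- A) (t k))^T)^T *m (X + t k *: W' k) *m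
      (V *m (cayley (- B) (t k))^T).
    by rewrite trmx_mul trmxK /Z !mulmxA.
  apply: (inner_frame_le lenm); first exact: singular_values_chamber.
    exact: orthogonal_mxM UU (orthogonal_mxT (cayley_orthogonal nskA _)).
  exact: orthogonal_mxM VV (orthogonal_mxT (cayley_orthogonal nskB _)).
have linE : inner (D y) (- A *m Z k - Z k *m - B) = t k * lin k.
  rewrite ZE mulmxDr mulmxDl opprD addrACA innerDr.
  rewrite (inner_rdiag_tangent lenm)// add0r -scalemxAr -scalemxAl -scalerBr.
  by rewrite innerZr.
rewrite innerY -/(Z k) linE innerBr.
have -> : 2 * lin k = (2^-1 * t k ^+ 2)^-1 * (t k * (t k * lin k)).
  by field; exact: lt0r_neq0.
rewrite -mulrDr subrK mulrC ler_pM2r// lerD2r; exact: frame.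
Qed.

(** The first-order term vanishes, as [Dy] is orthogonal to the tangent vectors at
    diagonal matrices; what remains is the limit in [trace_gap_lower_bound]. *)
Lemma cvg_trace_gap_curve (z : T -> 'cV[R]_n) :
  D (z k) @[k --> F] --> D (sigma X) ->
  (inner (sigma Y) (z k) - inner Y
     (U *m (cayley A (t k) *m D (z k) *m (cayley B (t k))^T) *m V^T)) *
    (2^-1 * t k ^+ 2)^-1 @[k --> F]
  --> - curvature A B (sigma Y) (D (sigma X)).
Proof.
move=> cz.
have gapE k : (inner y (z k) - inner Y
     (U *m (cayley A (t k) *m D (z k) *m (cayley B (t k))^T) *m V^T)) *
    (2^-1 * t k ^+ 2)^-1 = - ((2^-1 * t k ^+ 2)^-1 *
    (inner (D y) (cayley A (t k) *m D (z k) *m (cayley B (t k))^T - D (z k)) -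
     t k * inner (D y) (A *m D (z k) - D (z k) *m B))).
  rewrite innerY !mulmxA UU mul1mx -(mulmxA _ V^T) VV mulmx1.
  rewrite (inner_rdiag_tangent lenm)// mulr0 subr0 innerBr (inner_rdiag lenm).
  by rewrite -mulrN opprB mulrC.
under eq_cvg do rewrite gapE.
apply: cvgN; exact: (@cvg_orbit_curvature _ _ _ _ _ skewA skewB _ _ FF _ t_right y _ _ cz).
Qed.

End CurvatureBound.

(** * Second-order quotients of spectral functions *)

Section Quotients.
Context {R : realType}.
Local Open Scope ereal_scope.

Lemma quotient_shift (a b : \bar R) (c1 c2 k : R) : b \is a fin_num -> (0 < k)%R ->
  (a - b - c2%:E) * k%:E = (a - b - c1%:E) * k%:E + ((c1 - c2) * k)%:E.
Proof.
move=> b_fin k0; rewrite -(fineK b_fin); case: a => [a| |].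
- by rewrite -!EFinB -!EFinM -EFinD; congr (_%:E); ring.
- by rewrite !addye// gt0_mulye ?lte_fin// addye.
- by rewrite !addNye gt0_mulNye ?lte_fin.
Qed.

Lemma half_square_quotient (a t : R) : (0 < t)%R ->
  (t * a * (2^-1 * t ^+ 2)^-1 = a * (2^-1 * t)^-1)%R.
Proof. by move=> t0; field; exact: lt0r_neq0. Qed.

End Quotients.

Section SpectralFunctions.
Context {R : realType} {m n : nat} (lenm : (n <= m)%N).
Local Notation D := (@rdiag R m n).
Local Notation sigma := (@singular_values R m n).
Context (f : 'cV[R]_n -> \bar R) (X Y : 'M[R]_(m, n)).
Hypothesis f_sym : absolutely_symmetric f.
Hypothesis XY_subdiff : convex_subdiff (f \o sigma) X Y.
Local Notation x := (sigma X).
Local Notation y := (sigma Y).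
Local Open Scope ereal_scope.

Let fx_fin : f x \is a fin_num.
Proof. exact: XY_subdiff.1. Qed.

(** A subgradient of a spectral function is aligned with the base point: compare
    [X] with the matrix of the same singular values in the frame of [Y]. *)
Lemma subdiff_trace_eq : inner X Y = inner x y.
Proof.
apply/eqP; rewrite eq_le (von_neumann lenm)/=.
have [U [V [UU VV eY]]] := svd lenm Y.
have VT := orthogonal_mxT VV.
have yx : inner Y (U *m D x *m V^T) = inner x y.
  rewrite {1}eY inner_orthogonal; [|exact: UU|exact: VT].
  by rewrite (inner_rdiag lenm) innerC.
have := XY_subdiff.2 (U *m D x *m V^T).
rewrite /= singular_values_orthogonal; [|exact: UU|exact: VT].
rewrite (singular_values_rdiag lenm); last exact: singular_values_chamber.
by rewrite -(fineK fx_fin) -EFinD lee_fin gerDl innerBr subr_le0 yx (innerC Y X).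
Qed.

(** In a common frame of [X] and [Y] diagonal matrices test the subgradient
    inequality. *)
Lemma subdiff_singular_values z : f x + (inner y (z - x))%:E <= f z.
Proof.
pose M (b : bool) := if b then X else Y.
have [b1 b2|U [V [UU VV eM]]] := simultaneous_svd lenm (M := M).
  case: b1; case: b2; rewrite /M ?(inner_singular_values lenm)//.
    exact: subdiff_trace_eq.
  by rewrite innerC [RHS]innerC; exact: subdiff_trace_eq.
have VT := orthogonal_mxT VV.
have eX : X = U *m D x *m V^T := eM true.
have eY : Y = U *m D y *m V^T := eM false.
have := XY_subdiff.2 (U *m D z *m V^T); rewrite /= (spectral_rdiag lenm)//.
suff -> : inner Y (U *m D z *m V^T - X) = inner y (z - x) by [].
rewrite [in LHS]eX -mulmxBl -mulmxBr -rdiagB [in LHS]eY.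
by rewrite inner_orthogonal// (inner_rdiag lenm).
Qed.

Lemma second_quot_ge0 t z : (0 < t)%R -> 0 <= second_quot f x y t z.
Proof.
move=> t0; rewrite /second_quot mule_ge0//; last first.
  by rewrite lee_fin invr_ge0 mulr_ge0// sqr_ge0.
have := subdiff_singular_values (x + t *: z).
rewrite [(x + _)%R]addrC addrK innerZr [(_ *: _ + _)%R]addrC -(fineK fx_fin).
case: (f (x + t *: z)) => [a| |].
- by rewrite -EFinD -!EFinB !lee_fin; lra.
- by rewrite !addye.
- by rewrite -EFinD leeNy_eq.
Qed.

(** Insert [<y, sigma (X + t W) - x>]: the difference of the two linear terms is
    the gap in von Neumann's inequality, which vanishes at [X] by
    [subdiff_trace_eq]. *)
Lemma second_quot_spectral t W : (0 < t)%R ->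
  second_quot (f \o sigma) X Y t W =
  second_quot f x y t (t^-1 *: (sigma (X + t *: W) - x))%R +
  ((inner y (sigma (X + t *: W)) - inner Y (X + t *: W)) *
    (2^-1 * t ^+ 2)^-1)%:E.
Proof.
move=> t0; rewrite /second_quot /= scalerA mulfV ?gt_eqF// scale1r.
rewrite [(x + (_ - x))%R]addrC subrK.
rewrite (@quotient_shift _ _ _ (inner y (sigma (X + t *: W)) - inner y x)%R)//.
  rewrite innerZr innerBr mulrA mulfV ?gt_eqF// mul1r; congr (_ + (_ * _)%:E).
  rewrite innerDr innerZr (innerC Y X) subdiff_trace_eq (innerC y x).
  by rewrite opprD addrA addrAC.
by rewrite invr_gt0 mulr_gt0// exprn_gt0.
Qed.

(** The splitting along a parabolic curve of diagonals, which may leave the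
    chamber. *)
Lemma second_quot_parabolic t w z W : (0 < t)%R ->
  f (sigma (X + t *: W)) = f (x + t *: w + (2^-1 * t ^+ 2) *: z)%R ->
  subderiv f x w = (inner y w)%:E ->
  second_quot (f \o sigma) X Y t W = parabolic_quot f x w t z +
  ((inner y (x + t *: w + (2^-1 * t ^+ 2) *: z) - inner Y (X + t *: W)) *
    (2^-1 * t ^+ 2)^-1 - inner y z)%:E.
Proof.
move=> t0 fW dfw; have k0 : (0 < 2^-1 * t ^+ 2)%R by rewrite mulr_gt0// exprn_gt0.
rewrite /second_quot /parabolic_quot /= fW dfw -EFinM.
rewrite (@quotient_shift _ _ _ (t * inner y w)%R) ?invr_gt0//.
congr (_ + _%:E); rewrite !innerDr !innerZr (innerC Y X) subdiff_trace_eq (innerC x).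
move: (inner y x) (inner y w) (inner y z) (inner Y W) => a b c d.
by move: (2^-1 * t ^+ 2)%R k0 => k k0; field; exact: lt0r_neq0.
Qed.

Lemma trace_gap_ge0 Z : (0 <= inner y (sigma Z) - inner Y Z)%R.
Proof. by rewrite subr_ge0 (von_neumann lenm). Qed.

Section Direction.
Context (W : 'M[R]_(m, n)) (w : 'cV[R]_n).
Local Notation right_W := (filter_prod (0%R : R)^'+ (nbhs W)).

Let quot (tW : R * 'M[R]_(m, n)) : 'cV[R]_n :=
  (tW.1^-1 *: (sigma (X + tW.1 *: tW.2) - x))%R.

Hypothesis quot_cvg : quot tW @[tW --> right_W] --> w.

Let fst_right : tW.1 @[tW --> right_W] --> (0%R : R)^'+.
Proof. exact: cvg_fst. Qed.

Let snd_W : tW.2 @[tW --> right_W] --> W.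
Proof. exact: cvg_snd. Qed.

(** The gap vanishes at [X], hence is of order [t]. *)
Let gap_quot tW : (0 < tW.1)%R ->
  (inner y (sigma (X + tW.1 *: tW.2)) - inner Y (X + tW.1 *: tW.2) =
   tW.1 * (inner y (quot tW) - inner Y tW.2))%R.
Proof.
move=> t0; rewrite /quot innerZr mulrBr mulrA mulfV ?gt_eqF// mul1r.
rewrite innerBr innerDr innerZr (innerC Y X) subdiff_trace_eq (innerC x).
by rewrite opprD addrA.
Qed.

Let near_gt0 : \forall tW \near right_W, (0 < tW.1)%R.
Proof. exact: near_right_gt0 fst_right. Qed.

(** A positive first-order trace gap, divided by [t / 2], would drive the quotient
    to infinity, as the other term of the splitting is nonnegative. *)
Lemma critical_trace_eq : second_subderiv (f \o sigma) X Y W < +oo ->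
  inner Y W = inner y w.
Proof.
move=> fin_W; have gap_cvg : (inner y (quot tW) - inner Y tW.2)%R @[tW --> right_W]
    --> (inner y w - inner Y W)%R.
  by apply: cvgB; apply: cvg_inner => //; exact: cvg_cst.
have gap_ge0 : (0 <= inner y w - inner Y W)%R.
  apply: (cvgr_to_ge gap_cvg); near=> tW.
  have t0 : (0 < tW.1)%R by near: tW.
  by rewrite -(pmulr_rge0 _ t0) -gap_quot// trace_gap_ge0.
apply/eqP; rewrite eq_sym -subr_eq0; apply/negPn/negP => gap_neq0.
have gap_gt0 : (0 < inner y w - inner Y W)%R by rewrite lt_def gap_neq0.
move: fin_W; rewrite /second_subderiv (liminf_right_pinfty gap_gt0 gap_cvg) ?ltxx//.
near=> tW; have t0 : (0 < tW.1)%R by near: tW.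
rewrite second_quot_spectral// gap_quot// half_square_quotient//.
by rewrite leeDr// second_quot_ge0.
Unshelve. all: by end_near. Qed.

(** The same argument for the first-order excess of [f], the trace gap being
    nonnegative; the reverse inequality holds as [y] is a subgradient of [f]. *)
Lemma critical_subderiv : second_subderiv (f \o sigma) X Y W < +oo ->
  subderiv f x w = (inner y w)%:E.
Proof.
move=> fin_W; apply/eqP; rewrite eq_le; apply/andP; split; last first.
  apply/lee_addgt0Pr => e e0; rewrite -leeBlDr//.
  apply: liminf_right_ge; near=> tu.
  have t0 : (0 < tu.1)%R by near: tu; apply: near_right_gt0; exact: cvg_fst.
  have yu : (inner y w - e <= inner y tu.2)%R.
    near: tu; have yu_cvg : inner y tu.2 @[tu --> filter_prod (0%R : R)^'+ (nbhs w)]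
        --> inner y w by apply: cvg_inner; [exact: cvg_cst|exact: cvg_snd].
    by apply: (cvgr_ge _ yu_cvg); rewrite ltrBlDr ltrDl.
  apply: (@le_trans _ _ (inner y tu.2)%:E); first by rewrite -EFinB lee_fin.
  have := subdiff_singular_values (x + tu.1 *: tu.2).
  rewrite [(x + _)%R]addrC addrK innerZr [(_ *: _ + _)%R]addrC -(fineK fx_fin).
  case: (f (x + tu.1 *: tu.2)) => [a| |].
  - by rewrite -EFinD -EFinB -EFinM !lee_fin ler_pdivlMr//; lra.
  - by move=> _; rewrite addye// gt0_mulye ?leey// lte_fin invr_gt0.
  - by rewrite -EFinD leeNy_eq.
rewrite leNgt; apply/negP => lt_w.
have [b [yb bf]] : exists b : R, (inner y w < b)%R /\ b%:E < subderiv f x w.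
  move: lt_w; case: (subderiv f x w) => [c| |]//.
    by rewrite lte_fin => yc; exists ((inner y w + c) / 2)%R; rewrite lte_fin; split; lra.
  by move=> _; exists (inner y w + 1)%R; rewrite ltry ltrDl.
have b_gt : (0 < b - inner y w)%R by rewrite subr_gt0.
have b_cvg : (b - inner y (quot tW))%R @[tW --> right_W] --> (b - inner y w)%R.
  by apply: cvgB; [exact: cvg_cst|apply: cvg_inner => //; exact: cvg_cst].
move: fin_W; rewrite /second_subderiv (liminf_right_pinfty b_gt b_cvg) ?ltxx//.
have near_b : \forall tW \near right_W,
    b%:E < (f (x + tW.1 *: quot tW)%R - f x) * (tW.1^-1)%:E.
  have b_lt : b%:E < liminf_right
    (fun t u => (f (x + t *: u)%R - f x) * (t^-1)%:E) w by exact: bf.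
  exact: (cvg_pair fst_right quot_cvg) _ (liminf_right_gt b_lt).
near=> tW; have t0 : (0 < tW.1)%R by near: tW.
have k0 : (0 < (2^-1 * tW.1 ^+ 2)^-1)%R by rewrite invr_gt0 mulr_gt0// exprn_gt0.
rewrite second_quot_spectral//.
apply: (@le_trans _ _ (second_quot f x y tW.1 (quot tW))); last first.
  by rewrite leeDl// lee_fin mulr_ge0 ?trace_gap_ge0// ltW.
have : b%:E < (f (x + tW.1 *: quot tW)%R - f x) * (tW.1^-1)%:E by near: tW.
rewrite /second_quot -(fineK fx_fin).
case: (f (x + tW.1 *: quot tW)) => [a| |].
- rewrite -!EFinB -!EFinM lte_fin lee_fin ltr_pdivlMr// => ba.
  rewrite -half_square_quotient// ler_pM2r// mulrBr (mulrC _ b) lerD2r.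
  exact: ltW.
- by move=> _; rewrite !addye// gt0_mulye ?leey// lte_fin.
- by rewrite addNye gt0_mulNye// lte_fin invr_gt0.
Unshelve. all: by end_near. Qed.

(** Lower limits are superadditive over the splitting of the quotient. *)
Lemma second_subderiv_lower_bound (L : R) :
  (forall e, (0 < e)%R -> \forall tW \near right_W, (L - e <=
    (inner y (sigma (X + tW.1 *: tW.2)) - inner Y (X + tW.1 *: tW.2)) *
    (2^-1 * tW.1 ^+ 2)^-1)%R) ->
  second_subderiv f x y w + L%:E <= second_subderiv (f \o sigma) X Y W.
Proof.
move=> gap_lower.
have key (a : R) : a%:E < second_subderiv f x y w ->
    (a + L)%:E <= second_subderiv (f \o sigma) X Y W.
  move=> a_lt; apply/lee_addgt0Pr => e e0; rewrite -leeBlDr//.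
  have near_a : \forall tW \near right_W, a%:E < second_quot f x y tW.1 (quot tW).
    exact: (cvg_pair fst_right quot_cvg) _ (liminf_right_gt a_lt).
  have near_L := gap_lower e e0.
  apply: liminf_right_ge; near=> tW.
  have t0 : (0 < tW.1)%R by near: tW.
  rewrite second_quot_spectral// -EFinB -addrA EFinD leeD//.
    by apply: ltW; near: tW; exact: near_a.
  by rewrite lee_fin; near: tW; exact: near_L.
move: key; case: (second_subderiv f x y w) => [a| |] key.
- apply/lee_addgt0Pr => e e0; rewrite -leeBlDr//.
  have -> : a%:E + L%:E - e%:E = (a - e + L)%:E by congr (_%:E); ring.
  by apply: key; rewrite lte_fin; lra.
- rewrite addye//; suff -> : second_subderiv (f \o sigma) X Y W = +oo by [].
  by apply/eqyP => M _; rewrite -(subrK L M) key// ltry.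
- by rewrite addNye leNye.
Unshelve. all: by end_near. Qed.

End Direction.

End SpectralFunctions.

(** * Lifting parabolic recovery sequences *)

Section UpperBound.
Context {R : realType} {m n : nat} (lenm : (n <= m)%N).
Local Notation D := (@rdiag R m n).
Local Notation sigma := (@singular_values R m n).
Context (f : 'cV[R]_n -> \bar R) (X Y W : 'M[R]_(m, n)).
Hypothesis f_sym : absolutely_symmetric f.
Hypothesis XY_subdiff : convex_subdiff (f \o sigma) X Y.
Context (U : 'M[R]_m) (V : 'M[R]_n) (A : 'M[R]_m) (B : 'M[R]_n) (w : 'cV[R]_n).
Local Notation x := (sigma X).
Local Notation y := (sigma Y).
Hypotheses (UU : orthogonal_mx U) (VV : orthogonal_mx V).
Hypotheses (skewA : A^T = - A) (skewB : B^T = - B).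
Hypothesis eX : X = U *m D x *m V^T.
Hypothesis eY : Y = U *m D y *m V^T.
Hypothesis eW : W = U *m (D w + (A *m D x - D x *m B)) *m V^T.
Hypothesis dfw : subderiv f x w = (inner y w)%:E.

Let lifted_curve (t : R) (z : 'cV[R]_n) : 'M[R]_(m, n) :=
  U *m (cayley A t *m D (x + t *: w + (2^-1 * t ^+ 2) *: z) *m (cayley B t)^T) *m V^T.

(** A parabolic recovery sequence [z k] of [f] lifts to [M_(m,n)] by turning the
    frame along [(A, B)]; the lift has the direction [W]. *)
Lemma parabolic_lift (t : nat -> R) (z : nat -> 'cV[R]_n) (z0 : 'cV[R]_n) (a b : R) :
  (forall k, 0 < t k) -> t k @[k --> \oo] --> (0 : R) -> z k @[k --> \oo] --> z0 ->
  (parabolic_quot f x w (t k) (z k) @[k --> \oo] --> a%:E)%E ->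
  a - inner y z0 - curvature A B y (D x) < b ->
  forall e, 0 < e -> \forall k \near \oo, exists2 W', normF (W' - W) <= e &
    (second_quot (f \o sigma) X Y (t k) W' <= b%:E)%E.
Proof.
move=> t_gt0 t0 zz0 qa ab e e0; have t_right := cvg_right_seq t_gt0 t0.
(* The parabolic arc, read as a curve of first order in [t k]. *)
pose u k := w + (2^-1 * t k) *: z k.
have uw : u k @[k --> \oo] --> w.
  have := cvg_mx_add (cvg_cst w) (cvgZ (cvgM (cvg_cst (2^-1 : R)) t0) zz0).
  by rewrite mulr0 scale0r addr0; exact.
have uE k : x + t k *: w + (2^-1 * t k ^+ 2) *: z k = x + t k *: u k.
  rewrite /u scalerDr scalerA addrA; congr (_ + _ *: _); ring.
have cD : D (x + t k *: w + (2^-1 * t k ^+ 2) *: z k) @[k --> \oo] --> D x.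
  under eq_cvg do rewrite uE.
  apply: cvg_rdiag; have := cvg_mx_add (cvg_cst x) (cvgZ t0 uw).
  by rewrite scale0r addr0; exact.
pose W' k := (t k)^-1 *: (lifted_curve (t k) (z k) - X).
have W'E k : X + t k *: W' k = lifted_curve (t k) (z k).
  by rewrite /W' scalerA mulfV ?gt_eqF// scale1r addrC subrK.
have cW' : W' k @[k --> \oo] --> W.
  have curveE k : W' k = (t k)^-1 *: (U *m (cayley A (t k) *m D (x + t k *: u k) *m
      (cayley B (t k))^T) *m V^T - U *m D x *m V^T).
    by rewrite /W' /lifted_curve uE -eX.
  under eq_cvg do rewrite curveE.
  rewrite eW; exact: (@cvg_frame_curve R m n _ \oo _ t t_right U V A B x w u skewA skewB uw).
have fW k : f (sigma (X + t k *: W' k)) =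
    f (x + t k *: w + (2^-1 * t k ^+ 2) *: z k).
  rewrite W'E /lifted_curve.
  have -> : U *m (cayley A (t k) *m D (x + t k *: w + (2^-1 * t k ^+ 2) *: z k) *m
      (cayley B (t k))^T) *m V^T = U *m cayley A (t k) *m
      D (x + t k *: w + (2^-1 * t k ^+ 2) *: z k) *m (V *m cayley B (t k))^T.
    by rewrite trmx_mul !mulmxA.
  apply: (spectral_rdiag lenm _ f_sym).
    exact: orthogonal_mxM UU (cayley_orthogonal skewA _).
  exact: orthogonal_mxT (orthogonal_mxM VV (cayley_orthogonal skewB _)).
pose gap k := (inner y (x + t k *: w + (2^-1 * t k ^+ 2) *: z k) -
    inner Y (lifted_curve (t k) (z k))) * (2^-1 * t k ^+ 2)^-1 - inner y (z k).
have cgap : gap k @[k --> \oo] --> - curvature A B y (D x) - inner y z0.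
  apply: cvgB; first exact: (cvg_trace_gap_curve lenm UU VV skewA skewB eY t_right cD).
  by apply: cvg_inner => //; exact: cvg_cst.
have [q_fin qR] := (fine_cvgP _ _).1 qa.
have sum_cvg : (fine (parabolic_quot f x w (t k) (z k)) + gap k) @[k --> \oo] -->
    (a + (- curvature A B y (D x) - inner y z0)) by exact: cvgD qR cgap.
have sum_lt : a + (- curvature A B y (D x) - inner y z0) < b by move: ab; lra.
have W'_cvg0 : normF (W' k - W) @[k --> \oo] --> (0 : R) by exact/cvg_normF0.
have near_e : \forall k \near \oo, normF (W' k - W) <= e by exact: (cvgr_le _ W'_cvg0 _ e0).
have near_b : \forall k \near \oo, fine (parabolic_quot f x w (t k) (z k)) + gap k <= b.
  exact: (cvgr_le _ sum_cvg _ sum_lt).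
near=> k; exists (W' k); first by near: k; exact: near_e.
rewrite (second_quot_parabolic lenm XY_subdiff (t_gt0 k) (fW k) dfw).
rewrite W'E -/(gap k) -[parabolic_quot _ _ _ _ _]fineK; last by near: k; exact: q_fin.
by rewrite -EFinD lee_fin; near: k; exact: near_b.
Unshelve. all: by end_near. Qed.

End UpperBound.

Theorem proposition5p7 (R : realType) (m n : nat) (f : 'cV[R]_n -> \bar R)
    (X Y : 'M[R]_(m, n)) :
  (n <= m)%N ->
  absolutely_symmetric f ->
  lower_semicontinuous f ->
  convex_efun f ->
  locally_lipschitz_on_dom f ->
  convex_subdiff (f \o @singular_values R m n) X Y ->
  parabolically_epi_differentiable f (singular_values X) ->
  parabolically_regular f (singular_values X) (singular_values Y) ->
  twice_epi_differentiable (f \o @singular_values R m n) X Y.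
Proof.
move=> lenm f_sym _ _ _ XY_subdiff [_ f_epi] [_ f_reg].
set x := singular_values X in f_epi f_reg *; set y := singular_values Y in f_reg *.
split; [exact: XY_subdiff.1|move=> W].
have [infinite|finite] := eqVneq (second_subderiv (f \o @singular_values R m n) X Y W) +oo%E.
  exact: recovery_pinfty.
have {finite} W_fin : (second_subderiv (f \o @singular_values R m n) X Y W < +oo)%E.
  by rewrite ltey.
have XY := subdiff_trace_eq lenm XY_subdiff.
have [U0 [V0 [w [A0 [B0 [[UU0 VV0 skA0 skB0] [eX0 eW0 near_chamber]]]]]]] :=
  directional_frame lenm X W.
have quot_cvg : tW.1^-1 *: (singular_values (X + tW.1 *: tW.2) - singular_values X)
    @[tW --> filter_prod (0 : R)^'+ (nbhs W)] --> w.
  by apply: (cvg_singular_values_quotient lenm _ UU0 VV0 skA0 skB0 eX0 eW0 near_chamber);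
    [exact: cvg_fst|exact: cvg_snd].
have YW := critical_trace_eq lenm f_sym XY_subdiff quot_cvg W_fin.
have dfw := critical_subderiv lenm f_sym XY_subdiff quot_cvg W_fin.
have [U [V [A [B [[UU VV skA skB] [eX eY eW]]]]]] :=
  critical_frame lenm XY YW UU0 VV0 skA0 skB0 eX0 eW0 near_chamber.
set L := - curvature A B y (rdiag x).
have lower : (second_subderiv f x y w + L%:E <=
    second_subderiv (f \o @singular_values R m n) X Y W)%E.
  apply: (second_subderiv_lower_bound lenm XY_subdiff quot_cvg) => e e0.
  by apply: (trace_gap_lower_bound lenm UU VV skA skB eX eY eW _ _ e0);
    [exact: cvg_fst|exact: cvg_snd].
have reg_w := f_reg w dfw.
have ge0 : (0 <= second_subderiv f x y w)%E.
  apply: liminf_right_ge; near=> tu; apply: (second_quot_ge0 lenm f_sym XY_subdiff).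
  by near: tu; apply: near_right_gt0; exact: cvg_fst.
(* [L + second_subderiv f x y w] is a lower bound different from minus infinity. *)
have [l lE] : exists l : R, second_subderiv (f \o @singular_values R m n) X Y W = l%:E.
  move: lower W_fin; case: (second_subderiv _ _ _ W) => [l| |] // lower _.
    by exists l.
  move: lower; rewrite leeNy_eq adde_eq_ninfty /= orbF => /eqP eN.
  by move: ge0; rewrite eN.
apply: (recovery_of_approx lE) => t t_gt0 t0 e e0.
(* Parabolic regularity turns this into a nearly optimal [z]. *)
have inf_lt : (second_subderiv f x y w < (l - L + e)%:E)%E.
  move: lower; rewrite lE -leeBrDr// => /le_lt_trans; apply.
  by rewrite -EFinB lte_fin ltrDl.
move: (inf_lt); rewrite reg_w => /ereal_inf_lt[_ [z _ <-]] z_lt.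
have z_ge : (0 <= parabolic_subderiv f x w z - (inner y z)%:E)%E.
  by apply: le_trans ge0 _; rewrite reg_w; apply: ereal_inf_lbound; exists z.
have [a aE] : exists a : R, parabolic_subderiv f x w z = a%:E.
  by move: z_lt z_ge; case: (parabolic_subderiv f x w z) => [a| |] //; exists a.
have w_fin : subderiv f x w \is a fin_num by rewrite dfw.
have [u uz qa] := (f_epi w w_fin).2 z t t_gt0 t0.
rewrite aE in qa z_lt.
apply: (parabolic_lift lenm f_sym XY_subdiff UU VV skA skB eX eY eW dfw t_gt0 t0 uz qa _ e0).
by move: z_lt; rewrite -EFinB lte_fin /L; lra.
Unshelve. all: by end_near. Qed.
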